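(* Let $G$ be a finite abelian group and $\mathbb{F}$ an algebraically closed field. If $\mathcal{D}$ is a $G$-graded-division algebra over $\mathbb{F}$ with support $T$ and $\mathcal{A}$ is a direct limit of matrix algebras over $\mathbb{F}$ with elementary $G$-gradings, then $$K_0^G(\mathcal{A}\otimes\mathcal{D})\cong K_0^{G/T}({}^\alpha\mathcal{A}),$$ where $\alpha:G\to G/T$ is the quotient map.
   Context: All algebras are associative and unital over $\mathbb{F}$. A $G$-grading on $\mathcal{A}$ is a decomposition $\mathcal{A}=\bigoplus_{g\in G}\mathcal{A}_g$ into subspaces with $\mathcal{A}_g\mathcal{A}_h\subseteq\mathcal{A}_{gh}$; homomorphisms of graded algebras preserve components. The support is $\{g\mid\mathcal{A}_g\ne0\}$. A graded-division algebra is a $G$-graded unital algebra in which every nonzero homogeneous element is invertible; its support is a subgroup of $G$. Tensor products (over $\mathbb{F}$) are graded by $\deg(a\otimes b)=\deg a\deg b$. An elementary grading on $\mathrm{M}_n(\mathbb{F})$ is one of the form $\deg E_{ij}=g_ig_j^{-1}$ for some $(g_1,\dots,g_n)\in G^n$. ''Direct limit of matrix algebras with elementary gradings'' means the direct limit of a sequence $\mathcal{A}_0\to\mathcal{A}_1\to\mathcal{A}_2\to\cdots$ of unital embeddings of graded algebras, where each $\mathcal{A}_i$ is a matrix algebra over $\mathbb{F}$ with an elementary grading. For a group homomorphism $\alpha:G\to H$ and a $G$-graded algebra $\mathcal{A}$, ${}^\alpha\mathcal{A}$ is the algebra $\mathcal{A}$ with the $H$-grading $\mathcal{A}_h=\bigoplus_{g\in\alpha^{-1}(h)}\mathcal{A}_g$.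 Graded $K_0$: for an abelian group $H$ and a unital $H$-graded algebra $\mathcal{B}$, $K_0^{H}(\mathcal{B})^+$ is the commutative monoid (under $\oplus$) of isomorphism classes $[P]$ of finitely generated projective $H$-graded left $\mathcal{B}$-modules; $K_0^{H}(\mathcal{B})$ is its group completion, a $\mathbb{Z}H$-module via $h[P]=[P^{[h]}]$, where $P^{[h]}_k=P_{kh^{-1}}$. $K_0^{H}(\mathcal{B})$ also stands for the triple $(K_0^{H}(\mathcal{B}),K_0^{H}(\mathcal{B})^+,[\mathcal{B}])$. A morphism of triples $(K,K^+,u)\to(K',K'^+,u')$ is a module homomorphism $\varphi$ with $\varphi(K^+)\subseteq K'^+$ and $\varphi(u)=u'$. In the claim, $\cong$ is isomorphism of triples, where the $\mathbb{Z}(G/T)$-module $K_0^{G/T}({}^\alpha\mathcal{A})$ is regarded as a $\mathbb{Z}G$-module via $\alpha$. *)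

(* Defs.v *)
From HB Require Import structures.
From mathcomp Require Import all_boot all_order all_algebra all_fingroup.
From mathcomp Require Import boolp classical_sets.

Set Implicit Arguments.
Unset Strict Implicit.
Unset Printing Implicit Defensive.

Import GRing.Theory.
Local Open Scope ring_scope.

Lemma pair_ext (U V : Type) (x y : U * V) : x.1 = y.1 -> x.2 = y.2 -> x = y.
Proof. by case: x y => [? ?] [? ?] /= -> ->. Qed.

Section DirectSum.
Variables (I : finType) (V : zmodType) (C : I -> set V).

Definition is_direct_sum : Prop :=
  forall v : V, exists! f : {ffun I -> V},
    (forall i, C i (f i)) /\ v = \sum_i f i.

Definition is_subgroup (S : set V) : Prop :=
  S 0 /\ forall x y, S x -> S y -> S (x - y).

Lemma subgroupN S x : is_subgroup S -> S x -> S (- x).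
Proof. by move=> [S0 SB] Sx; rewrite -sub0r; apply: SB. Qed.

Lemma subgroupD S x y : is_subgroup S -> S x -> S y -> S (x + y).
Proof. by move=> hS Sx Sy; rewrite -[y]opprK; apply: hS.2 => //; apply: subgroupN. Qed.

Lemma subgroup_sum S (J : Type) (r : seq J) (P : pred J) (u : J -> V) :
  is_subgroup S -> (forall i, P i -> S (u i)) -> S (\sum_(i <- r | P i) u i).
Proof.
move=> hS hu; elim/big_rec: _ => [|i x Pi Sx]; first exact: hS.1.
by apply: subgroupD => //; apply: hu.
Qed.

Definition dproj (hC : is_direct_sum) (i : I) (v : V) : V :=
  (projT1 (cid (hC v))) i.

Lemma is_direct_sum_proj (pr : I -> V -> V) :
    (forall i v, C i (pr i v)) -> (forall v, v = \sum_i pr i v) ->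
    (forall i, {morph pr i : x y / x + y}) ->
    (forall i j v, C i v -> pr j v = if i == j then v else 0) ->
  is_direct_sum.
Proof.
move=> prC prS prD prE v; exists [ffun i => pr i v]; split.
  split=> [i|]; first by rewrite ffunE.
  by rewrite [LHS]prS; apply: eq_bigr => i _; rewrite ffunE.
move=> f [fC ->]; apply/ffunP => j; rewrite ffunE.
have pr0 : pr j 0 = 0.
  by apply: (addrI (pr j 0)); rewrite -prD !addr0.
rewrite (big_morph _ (prD j) pr0) (bigD1 j) //= big1 ?addr0.
  by rewrite (prE j) // eqxx.
by move=> i /negPf ij; rewrite (prE i) // ij.
Qed.

Hypothesis hC : is_direct_sum.
Hypothesis sC : forall i, is_subgroup (C i).

Lemma dprojC i v : C i (dproj hC i v).
Proof. by rewrite /dproj; case: cid => f [[]]. Qed.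

Lemma dprojS v : v = \sum_i dproj hC i v.
Proof. by rewrite /dproj; case: cid => f [[]]. Qed.

Lemma dproj_uniq (u : I -> V) v i :
  (forall j, C j (u j)) -> v = \sum_j u j -> dproj hC i v = u i.
Proof.
move=> uC uS; rewrite /dproj; case: cid => f /= [_ fu].
rewrite (fu [ffun j => u j]) ?ffunE //; split=> [j|]; first by rewrite ffunE.
by rewrite uS; apply: eq_bigr => j _; rewrite ffunE.
Qed.

Lemma dprojE i j v : C i v -> dproj hC j v = if i == j then v else 0.
Proof.
move=> iv; rewrite (dproj_uniq (u := fun j => if i == j then v else 0)) //.
  by move=> k; case: eqP => [<-|_] //; case: (sC k).
by rewrite -big_mkcond (big_pred1 i) //= => k; rewrite eq_sym.
Qed.

Lemma dprojD i : {morph dproj hC i : x y / x + y}.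
Proof.
move=> x y; rewrite (dproj_uniq (u := fun j => dproj hC j x + dproj hC j y)) //.
  by move=> j; apply: subgroupD => //; apply: dprojC.
by rewrite big_split /= -!dprojS.
Qed.
End DirectSum.

Section Functional.
Local Open Scope classical_set_scope.
Variables (F : fieldType) (V : lmodType F).

Lemma linear_functional (v : V) : v != 0 ->
  exists2 f : V -> F, linear (f : V -> F^o) & f v = 1.
Proof.
move=> v0.
pose P (W : set V) := (forall c x y, W x -> W y -> W (c *: x + y)) /\ ~ W v.
have [|W [[Wlin Wv] Wmax]] := Zorn_bigcup (P := P).
  move=> /= Fam FP tot; split; last by move=> [X FX Xv]; case: (FP _ FX).
  move=> c x y [X FX Xx] [Y FY Yy].
  have [XY|YX] := tot _ _ FX FY.
    by exists Y => //; apply: (FP _ FY).1 => //; apply: XY.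
  by exists X => //; apply: (FP _ FX).1 => //; apply: YX.
have W0 : W 0.
  apply: contrapT => nW0; apply: (Wmax [set 0]); last first.
    split=> [c x y -> ->|/= v0']; first by rewrite /= scaler0 addr0.
    by rewrite v0' eqxx in v0.
  have WF x : ~ W x.
    by move=> Wx; apply: nW0; have := Wlin (-1) x x Wx Wx; rewrite scaleN1r addNr.
  by split=> [x /WF//|/(_ 0 erefl) /WF].
have WZ c x : W x -> W (c *: x) by move=> Wx; rewrite -[_ *: _]addr0; apply: Wlin.
have WD x y : W x -> W y -> W (x + y).
  by move=> Wx Wy; rewrite -[x]scale1r; apply: Wlin.
have WN x : W x -> W (- x) by rewrite -scaleN1r; apply: WZ.
have WE x : exists c, W (x - c *: v).
  have [Wx|nWx] := pselect (W x); first by exists 0; rewrite scale0r subr0.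
  apply: contrapT => nc.
  apply: (Wmax [set y | exists2 w, W w & exists a, y = w + a *: x]).
    split=> [y Wy|]; first by exists y => //; exists 0; rewrite scale0r addr0.
    by move=> /(_ x) h; apply/nWx/h; exists 0 => //; exists 1; rewrite add0r scale1r.
  split=> [c y z [w Ww [a ->]] [w' Ww' [a' ->]]|].
    exists (c *: w + w'); first exact: Wlin.
    by exists (c * a + a'); rewrite scalerDr scalerDl scalerA addrACA.
  move=> [w Ww [a va]]; apply: nc; exists a^-1.
  have a0 : a != 0.
    by apply/eqP => a0; apply: Wv; rewrite va a0 scale0r addr0.
  rewrite va scalerDr scalerA mulVf // scale1r opprD addrCA addrN addr0.
  exact/WN/WZ.
pose f x := projT1 (cid (WE x)).
have fP x : W (x - f x *: v) by rewrite /f; case: cid.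
have fu x c : W (x - c *: v) -> f x = c.
  move=> Wc; apply: contrapT => /eqP; rewrite -subr_eq0 => fc.
  apply: Wv; have := WD _ _ Wc (WN _ (fP x)).
  rewrite opprB addrC addrA subrK -scalerBl => /(WZ (f x - c)^-1).
  by rewrite scalerA mulVf // scale1r.
exists f; last by apply: fu; rewrite scale1r subrr.
move=> c x y; apply: fu.
have -> : c *: x + y - (c *: (f x : F^o) + f y) *: v
    = c *: (x - f x *: v) + (y - f y *: v).
  by rewrite scalerDl scalerBr opprD addrACA -scalerA.
exact: Wlin.
Qed.
End Functional.

Section Tensor.
Local Notation repr := generic_quotient.repr.
Variables (F : fieldType) (A D : algType F).

Definition bilin (V : lmodType F) (b : A -> D -> V) : Prop :=
  (forall c a a' d, b (c *: a + a') d = c *: b a d + b a' d) /\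
  (forall c a d d', b a (c *: d + d') = c *: b a d + b a d').

Definition seval (V : lmodType F) (b : A -> D -> V) (s : seq (A * D)) : V :=
  \sum_(p <- s) b p.1 p.2.

(* A list of pairs stands for the formal sum of the tensors [a (x) d]; scalars
   are absorbed in the first factor.  Two formal sums are identified when no
   bilinear map separates them; [tens_lift] and [tens_lift_uniq] below are the
   resulting universal property. *)
Definition tens_rel (s t : seq (A * D)) : bool :=
  `[< forall (V : lmodType F) (b : A -> D -> V), bilin b -> seval b s = seval b t >].

Lemma tens_rel_refl : reflexive tens_rel.
Proof. by move=> s; apply/asboolP. Qed.

Lemma tens_rel_sym : symmetric tens_rel.
Proof.
by move=> s t; apply/asboolP/asboolP => st V b hb; rewrite st.
Qed.

Lemma tens_rel_trans : transitive tens_rel.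
Proof.
by move=> s t u /asboolP ts /asboolP su; apply/asboolP => V b hb; rewrite ts ?su.
Qed.

Definition tens_equiv := EquivRel tens_rel tens_rel_refl tens_rel_sym tens_rel_trans.

Definition tens : Type := {eq_quot tens_equiv}%qT.
HB.instance Definition _ := Choice.on tens.
HB.instance Definition _ := EqQuotient.on tens.

Definition tclass (s : seq (A * D)) : tens := \pi_(tens)%qT s.
Definition teval (V : lmodType F) (b : A -> D -> V) (x : tens) : V :=
  seval b (repr x).

Lemma teval_class (V : lmodType F) (b : A -> D -> V) s : bilin b -> teval b (tclass s) = seval b s.
Proof.
move=> hb; rewrite /teval /tclass.
have /eqquotP/asboolP := reprK (\pi_(tens)%qT s).
by apply.
Qed.

Lemma tens_ext (x y : tens) :
  (forall (V : lmodType F) (b : A -> D -> V), bilin b -> teval b x = teval b y) -> x = y.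
Proof.
move=> h; rewrite -[x]reprK -[y]reprK; apply/eqquotP/asboolP => V b hb.
exact: h.
Qed.

Definition tens_pure (a : A) (d : D) : tens := tclass [:: (a, d)].
Definition tens_zero : tens := tclass [::].
Definition tens_add (x y : tens) : tens := tclass (repr x ++ repr y).
Definition tens_scale (c : F) (x : tens) : tens :=
  tclass [seq (c *: p.1, p.2) | p <- repr x].
Definition tens_opp (x : tens) : tens := tens_scale (-1) x.
Definition tens_one : tens := tens_pure 1 1.
Definition tens_mul (x y : tens) : tens :=
  tclass [seq (p.1 * q.1, p.2 * q.2) | p <- repr x, q <- repr y].

Section Eval.
Variables (V : lmodType F) (b : A -> D -> V).
Hypothesis hb : bilin b.

Lemma bilinZl c a d : b (c *: a) d = c *: b a d.
Proof.
have b0 : b 0 d = 0.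
  have := hb.1 1 0 0 d; rewrite !scale1r addr0 => h.
  by apply: (addrI (b 0 d)); rewrite -h addr0.
by have := hb.1 c a 0 d; rewrite !addr0 b0 addr0.
Qed.

Lemma teval_pure a d : teval b (tens_pure a d) = b a d.
Proof. by rewrite teval_class // /seval big_seq1. Qed.
Lemma teval0 : teval b tens_zero = 0.
Proof. by rewrite teval_class // /seval big_nil. Qed.
Lemma tevalD x y : teval b (tens_add x y) = teval b x + teval b y.
Proof. by rewrite teval_class // /seval big_cat. Qed.
Lemma tevalZ c x : teval b (tens_scale c x) = c *: teval b x.
Proof.
rewrite teval_class // /seval big_map scaler_sumr.
by apply: eq_bigr => p _; rewrite bilinZl.
Qed.
Lemma tevalN x : teval b (tens_opp x) = - teval b x.
Proof. by rewrite tevalZ scaleN1r. Qed.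
Lemma tevalMl x y : teval b (tens_mul x y) =
  \sum_(p <- repr x) teval (fun a d => b (p.1 * a) (p.2 * d)) y.
Proof. by rewrite teval_class // /seval big_allpairs_dep. Qed.
Lemma tevalMr x y : teval b (tens_mul x y) =
  \sum_(q <- repr y) teval (fun a d => b (a * q.1) (d * q.2)) x.
Proof. by rewrite tevalMl exchange_big. Qed.
Lemma bilinMl a d : bilin (fun a' d' => b (a * a') (d * d')).
Proof.
split=> c x y z; first by rewrite mulrDr -scalerAr hb.1.
by rewrite mulrDr -scalerAr hb.2.
Qed.
Lemma bilinMr a d : bilin (fun a' d' => b (a' * a) (d' * d)).
Proof.
split=> c x y z; first by rewrite mulrDl -scalerAl hb.1.
by rewrite mulrDl -scalerAl hb.2.
Qed.
End Eval.

Lemma tens_addA : associative tens_add.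
Proof. by move=> x y z; apply: tens_ext => V b hb; rewrite !tevalD // addrA. Qed.
Lemma tens_addC : commutative tens_add.
Proof. by move=> x y; apply: tens_ext => V b hb; rewrite !tevalD // addrC. Qed.
Lemma tens_add0 : left_id tens_zero tens_add.
Proof. by move=> x; apply: tens_ext => V b hb; rewrite tevalD // teval0 // add0r. Qed.
Lemma tens_addN : left_inverse tens_zero tens_opp tens_add.
Proof.
by move=> x; apply: tens_ext => V b hb; rewrite tevalD // tevalN // teval0 // addNr.
Qed.
HB.instance Definition _ :=
  GRing.isZmodule.Build tens tens_addA tens_addC tens_add0 tens_addN.

Lemma tens_scaleA a b v : tens_scale a (tens_scale b v) = tens_scale (a * b) v.
Proof. by apply: tens_ext => V be hb; rewrite !tevalZ // scalerA. Qed.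
Lemma tens_scale1 : left_id 1 tens_scale.
Proof. by move=> x; apply: tens_ext => V be hb; rewrite !tevalZ // scale1r. Qed.
Lemma tens_scaleDr : right_distributive tens_scale +%R.
Proof.
by move=> c x y; apply: tens_ext => V be hb; rewrite !(tevalZ, tevalD) // scalerDr.
Qed.
Lemma tens_scaleDl v : {morph tens_scale^~ v : a b / a + b}.
Proof.
by move=> c d; apply: tens_ext => V be hb; rewrite !(tevalZ, tevalD) // scalerDl.
Qed.
HB.instance Definition _ := GRing.Zmodule_isLmodule.Build F tens
  tens_scaleA tens_scale1 tens_scaleDr tens_scaleDl.

Lemma tens_mulA : associative tens_mul.
Proof.
move=> x y z; apply: tens_ext => V b hb.
rewrite tevalMl // [RHS]tevalMr //.
under eq_bigr => p _ do rewrite (tevalMr (bilinMl hb _ _)).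
under [RHS]eq_bigr => q _ do rewrite (tevalMl (bilinMr hb _ _)).
rewrite exchange_big; apply: eq_bigr => q _; apply: eq_bigr => p _.
by apply: eq_bigr => r _ /=; rewrite !mulrA.
Qed.
Lemma tens_mul1 : left_id tens_one tens_mul.
Proof.
move=> x; apply: tens_ext => V b hb; rewrite tevalMr //.
apply: eq_bigr => p _; rewrite (teval_pure (bilinMr hb _ _)).
by rewrite !mul1r.
Qed.
Lemma tens_mulr1 : right_id tens_one tens_mul.
Proof.
move=> x; apply: tens_ext => V b hb; rewrite tevalMl //.
apply: eq_bigr => p _; rewrite (teval_pure (bilinMl hb _ _)).
by rewrite !mulr1.
Qed.
Lemma tens_mulDl : left_distributive tens_mul +%R.
Proof.
move=> x y z; apply: tens_ext => V b hb; rewrite tevalMr // tevalD // !tevalMr //.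
rewrite -big_split; apply: eq_bigr => p _ /=.
by rewrite (tevalD (bilinMr hb _ _)).
Qed.
Lemma tens_mulDr : right_distributive tens_mul +%R.
Proof.
move=> x y z; apply: tens_ext => V b hb; rewrite tevalMl // tevalD // !tevalMl //.
rewrite -big_split; apply: eq_bigr => p _ /=.
by rewrite (tevalD (bilinMl hb _ _)).
Qed.
Lemma tens_1_neq0 : tens_one != 0.
Proof.
have [f flin f1] := linear_functional (oner_neq0 A).
have [g glin g1] := linear_functional (oner_neq0 D).
pose b (a : A) (d : D) : F^o := f a * g d.
have hb : bilin b.
  split=> c x y z; rewrite /b.
    by rewrite flin mulrDl; congr (_ + _); rewrite /GRing.scale /= mulrA.
  by rewrite glin mulrDr; congr (_ + _); rewrite /GRing.scale /= mulrCA.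
apply/eqP => /(congr1 (teval b)).
rewrite (teval_pure hb) (teval0 hb) /b f1 g1 mulr1 => /eqP.
by rewrite oner_eq0.
Qed.
HB.instance Definition _ := GRing.Zmodule_isNzRing.Build tens
  tens_mulA tens_mul1 tens_mulr1 tens_mulDl tens_mulDr tens_1_neq0.

Lemma tens_scaleAl (c : F) (x y : tens) : c *: (x * y) = (c *: x) * y.
Proof.
apply: tens_ext => V b hb; rewrite tevalZ // !tevalMr // scaler_sumr.
by apply: eq_bigr => p _; rewrite (tevalZ (bilinMr hb _ _)).
Qed.
HB.instance Definition _ := GRing.Lmodule_isLalgebra.Build F tens tens_scaleAl.

Lemma tens_scaleAr (c : F) (x y : tens) : c *: (x * y) = x * (c *: y).
Proof.
apply: tens_ext => V b hb; rewrite tevalZ // !tevalMl // scaler_sumr.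
by apply: eq_bigr => p _; rewrite (tevalZ (bilinMl hb _ _)).
Qed.
HB.instance Definition _ := GRing.Lalgebra_isAlgebra.Build F tens tens_scaleAr.

Lemma teval_sum (V : lmodType F) (b : A -> D -> V) (J : Type) (r : seq J)
    (P : pred J) (u : J -> tens) : bilin b ->
  teval b (\sum_(i <- r | P i) u i) = \sum_(i <- r | P i) teval b (u i).
Proof. by move=> hb; apply: (big_morph _ (tevalD hb) (teval0 hb)). Qed.

Lemma tens_pure_bilin : bilin tens_pure.
Proof.
split=> c x y z; apply: tens_ext => V b hb.
  by rewrite tevalD // tevalZ // !teval_pure // hb.1.
by rewrite tevalD // tevalZ // !teval_pure // hb.2.
Qed.

Lemma tens_pureDl (d : D) : {morph (fun a : A => tens_pure a d) : x y / x + y}.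
Proof. by move=> x y; have := tens_pure_bilin.1 1 x y d; rewrite !scale1r. Qed.
Lemma tens_pureDr (a : A) : {morph (fun d : D => tens_pure a d) : x y / x + y}.
Proof. by move=> x y; have := tens_pure_bilin.2 1 a x y; rewrite !scale1r. Qed.
Lemma tens_pure0l d : tens_pure 0 d = 0.
Proof. by apply: (addrI (tens_pure 0 d)); rewrite -tens_pureDl !addr0. Qed.
Lemma tens_pure0r a : tens_pure a 0 = 0.
Proof. by apply: (addrI (tens_pure a 0)); rewrite -tens_pureDr !addr0. Qed.

Lemma tens_pureM a d a' d' :
  tens_pure a d * tens_pure a' d' = tens_pure (a * a') (d * d').
Proof.
apply: tens_ext => V b hb; rewrite [LHS]tevalMr //.
under eq_bigr => p _ do rewrite (teval_pure (bilinMr hb _ _)).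
rewrite (teval_pure hb) -[LHS]/(teval (fun x y => b (a * x) (d * y)) _).
by rewrite (teval_pure (bilinMl hb _ _)).
Qed.

Lemma tens_sum (x : tens) : x = \sum_(p <- repr x) tens_pure p.1 p.2.
Proof.
apply: tens_ext => V b hb; rewrite teval_sum //.
by apply: eq_bigr => p _; rewrite teval_pure.
Qed.

Lemma tens_lift (V : lmodType F) (b : A -> D -> V) : bilin b ->
  linear (teval b) /\ forall a d, teval b (tens_pure a d) = b a d.
Proof.
move=> hb; split=> [c x y|a d]; last exact: teval_pure.
by rewrite tevalD // tevalZ.
Qed.

Lemma tens_lift_uniq (V : lmodType F) (b : A -> D -> V) (L : {linear tens -> V}) :
  bilin b -> (forall a d, L (tens_pure a d) = b a d) -> L =1 teval b.
Proof.
move=> hb Lb x; rewrite {1}[x]tens_sum linear_sum.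
by apply: eq_bigr => p _; rewrite Lb.
Qed.
End Tensor.

Section Grading.
Variables (F : fieldType) (H : finGroupType).

Record grading (A : algType F) := Grading {
  homog :> H -> set A;
  homog_subspace : forall h, homog h 0 /\
    forall (c : F) x y, homog h x -> homog h y -> homog h (c *: x + y);
  homog_sum : is_direct_sum homog;
  homogM : forall g h x y,
    homog g x -> homog h y -> homog (g * h)%g (x * y) }.

Definition gsupport (A : algType F) (gA : grading A) (h : H) : Prop :=
  exists x, gA h x /\ x <> 0.

Definition graded_division (A : algType F) (gA : grading A) : Prop :=
  forall h x, gA h x -> x <> 0 -> exists y, x * y = 1 /\ y * x = 1.

Definition graded_hom (A B : algType F) (gA : grading A) (gB : grading B)
    (f : A -> B) : Prop :=
  forall h x, gA h x -> gB h (f x).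

Definition elementary n (gM : grading 'M[F]_n.+1) : Prop :=
  exists t : 'I_n.+1 -> H, forall i j, gM (t i * (t j)^-1)%g (delta_mx i j).

(* Colimit of a sequence in the category of [H]-graded algebras. *)
Definition is_direct_limit (M : nat -> algType F) (gM : forall i, grading (M i))
    (f : forall i, {lrmorphism M i -> M i.+1})
    (A : algType F) (gA : grading A) (phi : forall i, {lrmorphism M i -> A}) : Prop :=
  [/\ forall i, graded_hom (gM i) gA (phi i),
      forall i x, phi i.+1 (f i x) = phi i x &
      forall (C : algType F) (gC : grading C) (psi : forall i, {lrmorphism M i -> C}),
        (forall i, graded_hom (gM i) gC (psi i)) ->
        (forall i x, psi i.+1 (f i x) = psi i x) ->
        exists2 u : {lrmorphism A -> C},
          graded_hom gA gC u /\ (forall i x, u (phi i x) = psi i x) &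
          forall u' : {lrmorphism A -> C},
            graded_hom gA gC u' -> (forall i x, u' (phi i x) = psi i x) -> u' =1 u].

Definition limit_of_elementary (A : algType F) (gA : grading A) : Prop :=
  exists (n : nat -> nat)
         (gM : forall i, grading 'M[F]_((n i).+1))
         (f : forall i, {lrmorphism 'M[F]_((n i).+1) -> 'M[F]_((n i.+1).+1)})
         (phi : forall i, {lrmorphism 'M[F]_((n i).+1) -> A}),
    [/\ forall i, elementary (gM i),
        forall i, graded_hom (gM i) (gM i.+1) (f i),
        forall i, injective (f i) &
        is_direct_limit gM f gA phi].

Section GradingTheory.
Variables (A : algType F) (gA : grading A).

Lemma homog0 h : gA h 0. Proof. by case: (homog_subspace gA h). Qed.
Lemma homogP h c x y : gA h x -> gA h y -> gA h (c *: x + y).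
Proof. by case: (homog_subspace gA h) => _; apply. Qed.
Lemma homog_subgroup h : is_subgroup (gA h).
Proof.
split=> [|x y hx hy]; first exact: homog0.
by rewrite addrC -scaleN1r; apply: homogP.
Qed.
Lemma homogZ h c x : gA h x -> gA h (c *: x).
Proof. by move=> hx; rewrite -[_ *: _]addr0; apply: homogP => //; apply: homog0. Qed.

Definition gproj (h : H) (x : A) : A := dproj (homog_sum gA) h x.

Lemma gprojC h x : gA h (gproj h x). Proof. exact: dprojC. Qed.
Lemma gprojS x : x = \sum_h gproj h x. Proof. exact: dprojS. Qed.
Lemma gprojE g h x : gA g x -> gproj h x = if g == h then x else 0.
Proof. exact/dprojE/homog_subgroup. Qed.
Lemma gprojD h : {morph gproj h : x y / x + y}.
Proof. exact/dprojD/homog_subgroup. Qed.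
Lemma gproj_sum h (J : Type) (r : seq J) (P : pred J) (u : J -> A) :
  gproj h (\sum_(i <- r | P i) u i) = \sum_(i <- r | P i) gproj h (u i).
Proof.
apply: (big_morph _ (gprojD h)).
by rewrite (gprojE _ (homog0 h)) if_same.
Qed.
Lemma gprojP h c x y : gproj h (c *: x + y) = c *: gproj h x + gproj h y.
Proof.
rewrite gprojD; congr (_ + _); apply: (@dproj_uniq _ _ _ _ (fun h => c *: gproj h x)).
  by move=> k; apply/homogZ/gprojC.
by rewrite -scaler_sumr -gprojS.
Qed.
End GradingTheory.
End Grading.

Section Coarsen.
Variables (F : fieldType) (G H : finGroupType) (alpha : G -> H).
Hypothesis alphaM : {morph alpha : x y / (x * y)%g}.
Variables (A : algType F) (gA : grading G A).

Definition coarse_homog (h : H) (x : A) : Prop :=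
  exists f : G -> A, (forall g, gA g (f g)) /\ x = \sum_(g | alpha g == h) f g.

Fact coarse_subspace h : coarse_homog h 0 /\
  forall (c : F) x y, coarse_homog h x -> coarse_homog h y -> coarse_homog h (c *: x + y).
Proof.
split; first by exists (fun=> 0); split=> [g|]; [exact: homog0|rewrite big1].
move=> c _ _ [f [hf ->]] [f' [hf' ->]]; exists (fun g => c *: f g + f' g).
by split=> [g|]; [exact: homogP|rewrite scaler_sumr -big_split].
Qed.

Fact coarse_sum : is_direct_sum coarse_homog.
Proof.
apply: (is_direct_sum_proj (pr := fun h x => \sum_(g | alpha g == h) gproj gA g x)).
- by move=> h x; exists (fun g => gproj gA g x); split=> // g; exact: gprojC.
- move=> x; rewrite {1}[x](gprojS gA) (partition_big alpha predT) //.
- by move=> h x y; rewrite -big_split; apply: eq_bigr => g _; rewrite gprojD.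
move=> h k _ [f [hf ->]].
have fE g : gproj gA g (\sum_(g | alpha g == h) f g) = if alpha g == h then f g else 0.
  apply: (@dproj_uniq _ _ _ _ (fun g => if alpha g == h then f g else 0)).
    by move=> j; case: ifP => // _; exact: homog0.
  by rewrite -big_mkcond.
under eq_bigr => g _ do rewrite fE.
case: eqVneq => [<-|hk]; first by apply: eq_bigr => g ->.
by rewrite big1 // => g /eqP ->; rewrite eq_sym (negPf hk).
Qed.

Fact coarseM g h x y :
  coarse_homog g x -> coarse_homog h y -> coarse_homog (g * h)%g (x * y).
Proof.
move=> [f [hf ->]] [f' [hf' ->]].
exists (fun k => gproj gA k ((\sum_(i | alpha i == g) f i) * (\sum_(j | alpha j == h) f' j))).
split=> [k|]; first exact: gprojC.
rewrite big_distrl /=.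
under [in RHS]eq_bigr => k _ do rewrite gproj_sum.
rewrite exchange_big /=; apply: eq_bigr => i /eqP ig.
rewrite big_distrr /=.
under [in RHS]eq_bigr => k _ do rewrite gproj_sum.
rewrite exchange_big /=; apply: eq_bigr => j /eqP jh.
rewrite (bigD1 (i * j)%g) /=; last by rewrite alphaM ig jh.
rewrite (gprojE _ (homogM (hf i) (hf' j))) eqxx big1 ?addr0 // => k /andP[_ kij].
by rewrite (gprojE _ (homogM (hf i) (hf' j))) eq_sym (negPf kij).
Qed.

(* The grading of ${}^\alpha A$. *)
Definition coarsen : grading H A := Grading coarse_subspace coarse_sum coarseM.
End Coarsen.

Section TensorGrading.
Variables (F : fieldType) (G : finGroupType).
Hypothesis abG : abelian [set: G].
Variables (A D : algType F) (gA : grading G A) (gD : grading G D).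

Definition tens_homog (g : G) (x : tens A D) : Prop :=
  exists s : seq (A * D), x = \sum_(p <- s) tens_pure p.1 p.2 /\
    forall p, p \in s -> exists h k, [/\ gA h p.1, gD k p.2 & (h * k)%g = g].

Lemma tens_homog_pure h k a d :
  gA h a -> gD k d -> tens_homog (h * k)%g (tens_pure a d).
Proof.
move=> ha kd; exists [:: (a, d)]; split; first by rewrite big_seq1.
by move=> p; rewrite inE => /eqP ->; exists h, k.
Qed.

Fact tens_subspace g : tens_homog g 0 /\
  forall (c : F) x y, tens_homog g x -> tens_homog g y -> tens_homog g (c *: x + y).
Proof.
split; first by exists [::]; rewrite big_nil.
move=> c _ _ [s [-> hs]] [t [-> ht]].
exists ([seq (c *: p.1, p.2) | p <- s] ++ t); split.
  rewrite big_cat big_map scaler_sumr; congr (_ + _); apply: eq_bigr => p _ /=.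
  by rewrite (bilinZl (tens_pure_bilin A D)).
move=> p; rewrite mem_cat => /orP[/mapP[q /hs[h [k [hq kq e]]] ->]|/ht //].
by exists h, k; split=> //; apply: homogZ.
Qed.

Lemma tens_homog_subgroup g : is_subgroup (tens_homog g).
Proof.
split=> [|x y hx hy]; first by case: (tens_subspace g).
by rewrite addrC -scaleN1r; apply: (tens_subspace g).2.
Qed.

Definition tproj (g : G) : tens A D -> tens A D :=
  teval (fun a d => \sum_h tens_pure (gproj gA h a) (gproj gD (h^-1 * g)%g d)).

Lemma tproj_bilin g :
  bilin (fun a d => \sum_h tens_pure (gproj gA h a) (gproj gD (h^-1 * g)%g d)).
Proof.
split=> c x y z; rewrite scaler_sumr -big_split; apply: eq_bigr => h _ /=.
  by rewrite gprojP (tens_pure_bilin A D).1.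
by rewrite gprojP (tens_pure_bilin A D).2.
Qed.

Fact tens_dsum : is_direct_sum tens_homog.
Proof.
apply: (is_direct_sum_proj (pr := tproj)).
- move=> g x; apply: subgroup_sum => [|p _]; first exact: tens_homog_subgroup.
  apply: subgroup_sum => [|h _]; first exact: tens_homog_subgroup.
  by rewrite -{1}[g](mulKVg h); apply: tens_homog_pure; apply: gprojC.
- move=> x; rewrite {1}[x]tens_sum /tproj exchange_big; apply: eq_bigr => p _ /=.
  rewrite exchange_big /= {1}[p.1](gprojS gA).
  rewrite (big_morph _ (@tens_pureDl _ A D _) (tens_pure0l A _)); apply: eq_bigr => h _.
  rewrite {1}[p.2](gprojS gD) (big_morph _ (@tens_pureDr _ A D _) (tens_pure0r D _)).
  by rewrite (reindex_inj (mulgI h^-1%g)).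
- by move=> g x y; rewrite /tproj (tevalD (tproj_bilin g)).
move=> g k _ [s [-> hs]].
rewrite /tproj (teval_sum _ _ _ (tproj_bilin k)).
case: eqVneq => [<-|gk]; last first.
  rewrite big_seq big1 // => p /hs[h [l [hp lp e]]].
  rewrite (teval_pure (tproj_bilin k)) big1 // => i _.
  rewrite (gprojE _ hp) (gprojE _ lp); case: eqP => [<-|_]; last by rewrite tens_pure0l.
  case: eqP => [lk|_]; last by rewrite tens_pure0r.
  by case/eqP: gk; rewrite -e lk mulKVg.
apply: eq_big_seq => p /hs[h [l [hp lp e]]].
rewrite (teval_pure (tproj_bilin g)) (bigD1 h) //= big1 ?addr0.
  by rewrite (gprojE _ hp) (gprojE _ lp) eqxx -e mulKg eqxx.
move=> i; rewrite eq_sym => /negPf hi; by rewrite (gprojE _ hp) hi tens_pure0l.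
Qed.

Fact tens_homogM g g' x y :
  tens_homog g x -> tens_homog g' y -> tens_homog (g * g')%g (x * y).
Proof.
move=> [s [-> hs]] [t [-> ht]].
rewrite big_seq big_distrl; apply: subgroup_sum => [|p /hs[h [k [hp kp e]]]].
  exact: tens_homog_subgroup.
rewrite /= big_seq big_distrr; apply: subgroup_sum => [|q /ht[h' [k' [hq kq e']]]].
  exact: tens_homog_subgroup.
rewrite /= tens_pureM.
have -> : (g * g' = (h * h') * (k * k'))%g.
  have /centsP/(_ k (finset.in_setT k) h' (finset.in_setT h')) c := abG.
  by rewrite -e -e' !mulgA; congr (_ * _)%g; rewrite -!mulgA c.
by apply: tens_homog_pure; apply: homogM.
Qed.

Definition tens_grading : grading G (tens A D) :=
  Grading tens_subspace tens_dsum tens_homogM.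
End TensorGrading.

Section Quotient.
Variables (T : Type) (R : T -> T -> Prop).

(* The quotient of [T] by the equivalence relation [R], as its type of classes.
   It replaces [{eq_quot}] for types of modules, which live in a universe above
   the one of the algebraic structures. *)
Definition quot : Type := {X : T -> Prop | exists x, X = R x}.
Definition qclass (x : T) : quot := exist _ (R x) (ex_intro _ x erefl).
Definition qrepr (X : quot) : T := projT1 (cid (proj2_sig X)).

Hypotheses (Rrefl : forall x, R x x) (Rsym : forall x y, R x y -> R y x)
  (Rtrans : forall x y z, R x y -> R y z -> R x z).

Lemma qclassP x y : qclass x = qclass y <-> R x y.
Proof.
split=> [[e]|xy]; first by rewrite e; exact: Rrefl.
apply: eq_exist; apply/funext => z; apply/propext.
by split=> [xz|yz]; [apply: Rtrans (Rsym xy) xz|apply: Rtrans xy yz].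
Qed.

Lemma qreprK X : qclass (qrepr X) = X.
Proof.
case: X => X hX; rewrite /qrepr /=; case: cid => x /= e.
exact: eq_exist.
Qed.

Lemma qreprP x : R (qrepr (qclass x)) x.
Proof. by apply/qclassP; rewrite qreprK. Qed.
End Quotient.

Record cmonoid := CMonoid {
  cm_sort :> Type;
  cm0 : cm_sort;
  cmD : cm_sort -> cm_sort -> cm_sort;
  cmDA : forall x y z, cmD x (cmD y z) = cmD (cmD x y) z;
  cmDC : forall x y, cmD x y = cmD y x;
  cm0D : forall x, cmD cm0 x = x }.

(* A triple $(K, K^+, u)$.  A $\mathbb{Z}H$-module is given as an abelian group
   with an action of [H] by automorphisms. *)
Record triple (H : finGroupType) := Triple {
  t_sort :> Type;
  t0 : t_sort;
  tN : t_sort -> t_sort;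
  tD : t_sort -> t_sort -> t_sort;
  tact : H -> t_sort -> t_sort;
  tpos : t_sort -> Prop;
  tunit : t_sort;
  tDA : forall x y z, tD x (tD y z) = tD (tD x y) z;
  tDC : forall x y, tD x y = tD y x;
  t0D : forall x, tD t0 x = x;
  tND : forall x, tD (tN x) x = t0;
  tactD : forall h x y, tact h (tD x y) = tD (tact h x) (tact h y);
  tact1 : forall x, tact 1%g x = x;
  tactM : forall g h x, tact (g * h)%g x = tact g (tact h x) }.
Arguments t0 {H} _.
Arguments tpos {H} _ _.
Arguments tunit {H} _.

Record triple_hom (H : finGroupType) (K L : triple H) := TripleHom {
  th_fun :> K -> L;
  th_add : forall x y, th_fun (tD x y) = tD (th_fun x) (th_fun y);
  th_act : forall h x, th_fun (tact h x) = tact h (th_fun x);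
  th_pos : forall x, tpos K x -> tpos L (th_fun x);
  th_unit : th_fun (tunit K) = tunit L }.

Definition triple_iso (H : finGroupType) (K L : triple H) : Prop :=
  exists (f : triple_hom K L) (g : triple_hom L K), cancel f g /\ cancel g f.

Section Restrict.
Variables (G H : finGroupType) (alpha : G -> H).
Hypothesis alphaM : {morph alpha : x y / (x * y)%g}.
Variable K : triple H.

Fact restrict_act1 (x : K) : tact (alpha 1%g) x = x.
Proof.
have -> : alpha 1%g = 1%g by apply: (mulgI (alpha 1%g)); rewrite -alphaM !mulg1.
exact: tact1.
Qed.

Fact restrict_actM g h (x : K) :
  tact (alpha (g * h)%g) x = tact (alpha g) (tact (alpha h) x).
Proof. by rewrite alphaM tactM. Qed.

Definition restrict : triple G :=
  @Triple G K (t0 K) (@tN _ K) (@tD _ K) (fun g => tact (alpha g)) (tpos K) (tunit K)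
    (@tDA _ K) (@tDC _ K) (@t0D _ K) (@tND _ K) (fun g => @tactD _ K (alpha g))
    restrict_act1 restrict_actM.
End Restrict.

Section GroupCompletion.
Variable M : cmonoid.

Definition gc_rel (p q : M * M) : Prop :=
  exists r, cmD (cmD p.1 q.2) r = cmD (cmD q.1 p.2) r.

(* The class of [(p, q)] is the formal difference $p - q$. *)
Definition gc : Type := quot gc_rel.

Local Notation "x + y" := (cmD x y).

Lemma cmDCA (x y z : M) : x + (y + z) = y + (x + z).
Proof. by rewrite cmDA (cmDC x) -cmDA. Qed.
Lemma cmDAC (x y z : M) : x + y + z = x + z + y.
Proof. by rewrite -cmDA (cmDC y) cmDA. Qed.
Lemma cmDACA (x y z t : M) : (x + y) + (z + t) = (x + z) + (y + t).
Proof. by rewrite -!cmDA (cmDCA y). Qed.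

Lemma gc_refl p : gc_rel p p. Proof. by exists (cm0 M). Qed.
Lemma gc_sym p q : gc_rel p q -> gc_rel q p.
Proof. by move=> [r e]; exists r. Qed.
Lemma gc_trans p q s : gc_rel p q -> gc_rel q s -> gc_rel p s.
Proof.
move=> [r e] [r' e']; exists (q.2 + (r + r')).
rewrite cmDACA (cmDCA s.2) cmDA e (cmDACA s.1) (cmDC r) (cmDCA p.2) [RHS]cmDA -e'.
by rewrite -(cmDA q.1 p.2) -(cmDA q.1 s.2) cmDAC.
Qed.

Definition gc_class (p : M * M) : gc := qclass gc_rel p.

Lemma gc_classP p q : gc_class p = gc_class q <-> gc_rel p q.
Proof. exact: (qclassP gc_refl gc_sym gc_trans). Qed.

Lemma gc_ex x : exists p, x = gc_class p.
Proof. by exists (qrepr x); rewrite /gc_class qreprK. Qed.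

Definition gcD (x y : gc) : gc :=
  gc_class ((qrepr x).1 + (qrepr y).1, (qrepr x).2 + (qrepr y).2).
Definition gcN (x : gc) : gc := gc_class ((qrepr x).2, (qrepr x).1).
Definition gc0 : gc := gc_class (cm0 M, cm0 M).
Definition gc_of (m : M) : gc := gc_class (m, cm0 M).
Definition gc_map (phi : M -> M) (x : gc) : gc :=
  gc_class (phi (qrepr x).1, phi (qrepr x).2).

Lemma gc_reprP p : gc_rel (qrepr (gc_class p)) p.
Proof. exact: (qreprP gc_refl gc_sym gc_trans). Qed.

Lemma gcD_class p q : gcD (gc_class p) (gc_class q) = gc_class (p.1 + q.1, p.2 + q.2).
Proof.
apply/gc_classP; have [r e] := gc_reprP p; have [r' e'] := gc_reprP q.
exists (r + r') => /=.
by rewrite (cmDACA _ _ p.2) (cmDACA _ _ r) e e' (cmDACA _ r) (cmDACA p.1).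
Qed.

Lemma gcN_class p : gcN (gc_class p) = gc_class (p.2, p.1).
Proof.
apply/gc_classP; have [r e] := gc_reprP p; exists r => /=.
by rewrite (cmDC _ p.1) (cmDC p.2) e.
Qed.

Lemma gc_map_class phi p : (forall x y, phi (x + y) = phi x + phi y) ->
  gc_map phi (gc_class p) = gc_class (phi p.1, phi p.2).
Proof.
move=> phiD; apply/gc_classP; have [r e] := gc_reprP p; exists (phi r) => /=.
by rewrite -!phiD e.
Qed.

Lemma gcDA x y z : gcD x (gcD y z) = gcD (gcD x y) z.
Proof.
have [p ->] := gc_ex x; have [q ->] := gc_ex y; have [s ->] := gc_ex z.
by rewrite !gcD_class /= !cmDA.
Qed.
Lemma gcDC x y : gcD x y = gcD y x.
Proof.
have [p ->] := gc_ex x; have [q ->] := gc_ex y.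
by rewrite !gcD_class /= (cmDC p.1) (cmDC p.2).
Qed.
Lemma gc0D x : gcD gc0 x = x.
Proof. by have [[p q] ->] := gc_ex x; rewrite gcD_class /= !cm0D. Qed.
Lemma gcND x : gcD (gcN x) x = gc0.
Proof.
have [[p q] ->] := gc_ex x; rewrite gcN_class gcD_class /=.
by apply/gc_classP; exists (cm0 M); rewrite /= (cmDC q p) (cmDC (p + q) (cm0 M)).
Qed.
Lemma gc_mapD phi x y : (forall x y, phi (x + y) = phi x + phi y) ->
  gc_map phi (gcD x y) = gcD (gc_map phi x) (gc_map phi y).
Proof.
move=> phiD; have [p ->] := gc_ex x; have [q ->] := gc_ex y.
by rewrite gcD_class !gc_map_class // gcD_class /= !phiD.
Qed.
End GroupCompletion.

Section Modules.
Variable R : pzRingType.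

Definition mklinear (U V : lmodType R) (f : U -> V) (hf : linear f) : {linear U -> V} :=
  HB.pack f (GRing.isLinear.Build _ _ _ _ f hf).

Definition finitely_generated (P : lmodType R) : Prop :=
  exists n (e : 'I_n -> P), forall x, exists c : 'I_n -> R, x = \sum_i c i *: e i.

Definition projective (P : lmodType R) : Prop :=
  forall (M N : lmodType R) (p : {linear M -> N}) (f : {linear P -> N}),
    (forall y, exists x, p x = y) ->
    exists g : {linear P -> M}, forall x, p (g x) = f x.

Lemma finitely_generated_prod (P Q : lmodType R) :
  finitely_generated P -> finitely_generated Q -> finitely_generated (P * Q)%type.
Proof.
move=> [m [e he]] [n [e' he']].
exists (m + n)%N, (fun k => match split k with inl i => (e i, 0) | inr j => (0, e' j) end).
move=> [x y]; have [c ->] := he x; have [c' ->] := he' y.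
exists (fun k => match split k with inl i => c i | inr j => c' j end).
rewrite big_split_ord /=.
under [X in _ = X + _]eq_bigr => i _ do rewrite (unsplitK (inl i) : split (lshift n i) = inl i).
under [X in _ = _ + X]eq_bigr => i _ do rewrite (unsplitK (inr i) : split (rshift m i) = inr i).
have fstS (I : Type) (r : seq I) (u : I -> P * Q) : (\sum_(i <- r) u i).1 = \sum_(i <- r) (u i).1.
  exact: (big_morph fst).
have sndS (I : Type) (r : seq I) (u : I -> P * Q) : (\sum_(i <- r) u i).2 = \sum_(i <- r) (u i).2.
  exact: (big_morph snd).
apply/pair_equal_spec; split; rewrite /= ?fstS ?sndS /=.
  by rewrite [X in _ + X]big1 ?addr0 // => i _; rewrite scaler0.
by rewrite [X in X + _]big1 ?add0r // => i _; rewrite scaler0.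
Qed.

Lemma projective_prod (P Q : lmodType R) :
  projective P -> projective Q -> projective (P * Q)%type.
Proof.
move=> hP hQ M N p f ps.
have fl1 : linear (fun x : P => f (x, 0)).
  by move=> c x y; rewrite -linearP; congr (f _); apply/pair_equal_spec;
    split; rewrite //= scaler0 addr0.
have fl2 : linear (fun y : Q => f (0, y)).
  by move=> c x y; rewrite -linearP; congr (f _); apply/pair_equal_spec;
    split; rewrite //= scaler0 addr0.
have [g1 h1] := hP M N p (mklinear fl1) ps.
have [g2 h2] := hQ M N p (mklinear fl2) ps.
have gl : linear (fun z : P * Q => g1 z.1 + g2 z.2).
  by move=> c x y; rewrite !linearP scalerDr addrACA.
exists (mklinear gl) => -[x y] /=; rewrite linearD h1 h2 /= -linearD.
by congr (f _); apply/pair_equal_spec; rewrite /= addr0 add0r.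
Qed.

Lemma finitely_generated_regular : finitely_generated R^o.
Proof.
exists 1%N, (fun=> 1) => x; exists (fun=> x).
by rewrite big_ord1 /GRing.scale /= mulr1.
Qed.

Lemma projective_regular : projective R^o.
Proof.
move=> M N p f ps; have [m pm] := ps (f 1).
have gl : linear (fun x : R^o => (x : R) *: m) by move=> c x y; rewrite scalerDl scalerA.
exists (mklinear gl) => x /=; rewrite linearZ pm -linearZ.
by rewrite /GRing.scale /= mulr1.
Qed.

Lemma finitely_generated_rV0 : finitely_generated 'rV[R]_0.
Proof. by exists 0%N, (fun=> 0) => x; exists (fun=> 0); rewrite big_ord0 thinmx0. Qed.

Lemma projective_rV0 : projective 'rV[R]_0.
Proof.
move=> M N p f _.
have gl : linear (fun _ : 'rV[R]_0 => 0 : M) by move=> c x y; rewrite scaler0 addr0.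
by exists (mklinear gl) => x; rewrite /= [x]thinmx0 !linear0.
Qed.
End Modules.

Section GradedK0.
Variables (F : fieldType) (H : finGroupType) (B : algType F) (gB : grading H B).

(* Projectivity is that of the underlying left [B]-module; for graded modules it
   is equivalent to projectivity in the category of graded modules. *)
Record fgproj := FGProj {
  fg_mod :> lmodType B;
  fg_homog : H -> set fg_mod;
  fg_subgroup : forall h, is_subgroup (fg_homog h);
  fg_sum : is_direct_sum fg_homog;
  fg_act : forall g h b x,
    gB g b -> fg_homog h x -> fg_homog (g * h)%g (b *: x);
  fg_fin : finitely_generated fg_mod;
  fg_proj : projective fg_mod }.

Arguments fg_sum : clear implicits.

Definition fg_iso (P Q : fgproj) : Prop :=
  exists f : {linear P -> Q},
    bijective f /\ forall h x, fg_homog h x <-> fg_homog h (f x).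

Lemma fg_iso_refl P : fg_iso P P.
Proof.
have l : linear (@id P) by [].
by exists (mklinear l); split=> //; exists id.
Qed.

Lemma fg_iso_sym P Q : fg_iso P Q -> fg_iso Q P.
Proof.
move=> [f [[g fg gf] hf]].
have l : linear g by move=> c x y; apply: (can_inj fg); rewrite linearP !gf.
exists (mklinear l); split; first by exists f.
by move=> h x /=; rewrite hf gf.
Qed.

Lemma fg_iso_trans P Q S : fg_iso P Q -> fg_iso Q S -> fg_iso P S.
Proof.
move=> [f [bf hf]] [g [bg hg]].
have l : linear (g \o f) by move=> c x y; rewrite /= !linearP.
exists (mklinear l); split; first exact: bij_comp.
by move=> h x /=; rewrite hf hg.
Qed.

Section DirectSumModules.
Variables P Q : fgproj.

Definition sum_homog (h : H) (x : P * Q) : Prop := fg_homog h x.1 /\ fg_homog h x.2.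

Fact sum_subgroup h : is_subgroup (sum_homog h).
Proof.
split; first by split; apply: (fg_subgroup _ h).1.
by move=> x y [x1 x2] [y1 y2]; split; apply: (fg_subgroup _ h).2.
Qed.

Fact sum_sum : is_direct_sum sum_homog.
Proof.
apply: (@is_direct_sum_proj _ (P * Q)%type _
  (fun h x => (dproj (fg_sum P) h x.1, dproj (fg_sum Q) h x.2))).
- by move=> h x; split; apply: dprojC.
- move=> x; apply: pair_ext => /=.
    rewrite [LHS](dprojS (fg_sum P)); apply/esym.
    exact: (big_morph fst (fun _ _ => erefl) erefl).
  rewrite [LHS](dprojS (fg_sum Q)); apply/esym.
  exact: (big_morph snd (fun _ _ => erefl) erefl).
- move=> h x y; apply: pair_ext;
  by apply: dprojD => ?; apply: fg_subgroup.
move=> g h [x y] [/= gx gy]; rewrite (dprojE _ _ _ gx) ?(dprojE _ _ _ gy); first by case: eqP.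
all: exact: fg_subgroup.
Qed.

Fact sum_act g h b x : gB g b -> sum_homog h x -> sum_homog (g * h)%g (b *: x).
Proof. by move=> gb [h1 h2]; split; apply: fg_act. Qed.

Definition fg_oplus : fgproj :=
  FGProj sum_subgroup sum_sum sum_act
    (finitely_generated_prod (fg_fin P) (fg_fin Q))
    (projective_prod (@fg_proj P) (@fg_proj Q)).
End DirectSumModules.

Section Shift.
Variables (h : H) (P : fgproj).

Definition shift_homog (k : H) (x : P) : Prop := fg_homog (k * h^-1)%g x.

Fact shift_subgroup k : is_subgroup (shift_homog k).
Proof. exact: fg_subgroup. Qed.

Fact shift_sum : is_direct_sum shift_homog.
Proof.
apply: (is_direct_sum_proj (pr := fun k x => dproj (fg_sum P) (k * h^-1)%g x)).
- by move=> k x; apply: dprojC.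
- by move=> x; rewrite {1}[x](dprojS (fg_sum P)) (reindex_inj (mulIg h^-1%g)).
- by move=> k x y; apply: dprojD => ?; apply: fg_subgroup.
move=> g k x; rewrite /shift_homog => gx.
rewrite (dprojE _ _ _ gx); last exact: fg_subgroup.
by rewrite (inj_eq (mulIg _)).
Qed.

Fact shift_act g k b x : gB g b -> shift_homog k x -> shift_homog (g * k)%g (b *: x).
Proof. by move=> gb kx; rewrite /shift_homog -mulgA; apply: fg_act. Qed.

(* $P^{[h]}$, with $P^{[h]}_k = P_{kh^{-1}}$. *)
Definition fg_shift : fgproj :=
  FGProj shift_subgroup shift_sum shift_act (@fg_fin P) (@fg_proj P).
End Shift.

Fact reg_act g h (b x : B) : gB g b -> gB h x -> gB (g * h)%g (b * x).
Proof. exact: homogM. Qed.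

Definition fg_regular : fgproj :=
  @FGProj B^o (gB : H -> set B^o) (homog_subgroup gB) (homog_sum gB) reg_act
    (finitely_generated_regular B) (@projective_regular B).

Definition zero_homog (h : H) (x : 'rV[B]_0) : Prop := True.
Fact zero_subgroup h : is_subgroup (zero_homog h). Proof. by []. Qed.
Fact zero_sum : is_direct_sum zero_homog.
Proof.
have rV0 (x y : 'rV[B]_0) : x = y by rewrite [x]thinmx0 [y]thinmx0.
move=> v; exists [ffun=> 0]; split; first by split=> //; apply: rV0.
by move=> f _; apply/ffunP => i; apply: rV0.
Qed.
Fact zero_act g h (b : B) x :
  gB g b -> zero_homog h x -> zero_homog (g * h)%g (b *: x).
Proof. by []. Qed.

Definition fg_zero : fgproj :=
  FGProj zero_subgroup zero_sum zero_act
    (finitely_generated_rV0 B) (@projective_rV0 B).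

Lemma oplus_iso P P' Q Q' :
  fg_iso P P' -> fg_iso Q Q' -> fg_iso (fg_oplus P Q) (fg_oplus P' Q').
Proof.
move=> [f [[f' ff' f'f] hf]] [g [[g' gg' g'g] hg]].
have l : linear (fun x : P * Q => (f x.1, g x.2) : P' * Q').
  by move=> c x y; rewrite /= !linearP.
exists (mklinear l : {linear fg_oplus P Q -> fg_oplus P' Q'}); split.
  exists (fun y : P' * Q' => (f' y.1, g' y.2)) => -[x y] /=.
    by rewrite ff' gg'.
  by rewrite f'f g'g.
by move=> h [x y]; split=> -[/= hx hy]; split=> /=;
  rewrite ?(hf, hg) // -?(hf, hg).
Qed.

Lemma oplusA_iso P Q S :
  fg_iso (fg_oplus P (fg_oplus Q S)) (fg_oplus (fg_oplus P Q) S).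
Proof.
have l : linear (fun x : P * (Q * S) => ((x.1, x.2.1), x.2.2) : P * Q * S) by [].
exists (mklinear l : {linear fg_oplus P (fg_oplus Q S) -> fg_oplus (fg_oplus P Q) S}).
split; first by exists (fun x : P * Q * S => (x.1.1, (x.1.2, x.2))) => [[? []]|[[]]].
by move=> h [x [y z]]; split=> [[/= ? []]|[/= []]].
Qed.

Lemma oplusC_iso P Q : fg_iso (fg_oplus P Q) (fg_oplus Q P).
Proof.
have l : linear (fun x : P * Q => (x.2, x.1) : Q * P) by [].
exists (mklinear l : {linear fg_oplus P Q -> fg_oplus Q P}).
split; first by exists (fun x : Q * P => (x.2, x.1)) => -[].
by move=> h [x y]; split=> -[].
Qed.

Lemma oplus0_iso P : fg_iso (fg_oplus fg_zero P) P.
Proof.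
have l : linear (fun x : 'rV[B]_0 * P => x.2) by [].
exists (mklinear l : {linear fg_oplus fg_zero P -> P}).
split; first exists (fun x : P => (0, x)) => [[x y]|//] /=.
  by rewrite [x]thinmx0.
by move=> h [x y]; split=> [[]|].
Qed.

Lemma shift_iso h P Q : fg_iso P Q -> fg_iso (fg_shift h P) (fg_shift h Q).
Proof.
move=> [f [bf hf]]; exists (f : {linear fg_shift h P -> fg_shift h Q}).
by split=> // k x; apply: hf.
Qed.

Lemma shift_oplus_iso h P Q :
  fg_iso (fg_shift h (fg_oplus P Q)) (fg_oplus (fg_shift h P) (fg_shift h Q)).
Proof.
have l : linear (@id (P * Q)) by [].
exists (mklinear l : {linear fg_shift h (fg_oplus P Q) ->
                             fg_oplus (fg_shift h P) (fg_shift h Q)}).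
by split=> //; exists id.
Qed.

Definition K0pos : Type := quot fg_iso.
Definition K0class (P : fgproj) : K0pos := qclass fg_iso P.

Lemma K0classP P Q : K0class P = K0class Q <-> fg_iso P Q.
Proof. exact: (qclassP fg_iso_refl fg_iso_sym fg_iso_trans). Qed.
Lemma K0class_ex x : exists P, x = K0class P.
Proof. by exists (qrepr x); rewrite /K0class qreprK. Qed.
Lemma K0class_repr P : fg_iso (qrepr (K0class P)) P.
Proof. exact: (qreprP fg_iso_refl fg_iso_sym fg_iso_trans). Qed.

Definition K0posD (x y : K0pos) : K0pos := K0class (fg_oplus (qrepr x) (qrepr y)).
Definition K0shift (h : H) (x : K0pos) : K0pos := K0class (fg_shift h (qrepr x)).

Lemma K0posD_class P Q : K0posD (K0class P) (K0class Q) = K0class (fg_oplus P Q).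
Proof. by apply/K0classP/oplus_iso; apply: K0class_repr. Qed.
Lemma K0shift_class h P : K0shift h (K0class P) = K0class (fg_shift h P).
Proof. by apply/K0classP/shift_iso/K0class_repr. Qed.

Fact K0posDA x y z : K0posD x (K0posD y z) = K0posD (K0posD x y) z.
Proof.
have [P ->] := K0class_ex x; have [Q ->] := K0class_ex y; have [S ->] := K0class_ex z.
by rewrite !K0posD_class; apply/K0classP/oplusA_iso.
Qed.
Fact K0posDC x y : K0posD x y = K0posD y x.
Proof.
have [P ->] := K0class_ex x; have [Q ->] := K0class_ex y.
by rewrite !K0posD_class; apply/K0classP/oplusC_iso.
Qed.
Fact K0pos0D x : K0posD (K0class fg_zero) x = x.
Proof.
by have [P ->] := K0class_ex x; rewrite K0posD_class; apply/K0classP/oplus0_iso.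
Qed.
Definition K0monoid : cmonoid := CMonoid K0posDA K0posDC K0pos0D.

Lemma K0shiftD h x y : K0shift h (K0posD x y) = K0posD (K0shift h x) (K0shift h y).
Proof.
have [P ->] := K0class_ex x; have [Q ->] := K0class_ex y.
by rewrite !(K0posD_class, K0shift_class); apply/K0classP/shift_oplus_iso.
Qed.
Lemma K0shift1 x : K0shift 1%g x = x.
Proof.
have [P ->] := K0class_ex x; rewrite K0shift_class; apply/K0classP.
have l : linear (@id P) by [].
exists (mklinear l : {linear fg_shift 1%g P -> P}); split; first by exists id.
by move=> h x'; rewrite /= /shift_homog invg1 mulg1.
Qed.

Hypothesis abH : abelian [set: H].

Lemma K0shiftM g h x : K0shift (g * h)%g x = K0shift g (K0shift h x).
Proof.
have [P ->] := K0class_ex x; rewrite !K0shift_class; apply/K0classP.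
have l : linear (@id P) by [].
exists (mklinear l : {linear fg_shift (g * h)%g P -> fg_shift g (fg_shift h P)}).
split; first by exists id.
have /centsP/(_ g (finset.in_setT g) h (finset.in_setT h)) c := abH.
by move=> k x'; rewrite /= /shift_homog /= /shift_homog -mulgA -invMg c.
Qed.

Local Notation K0gc := (gc K0monoid).

Definition K0act (h : H) (x : K0gc) : K0gc := gc_map (K0shift h : K0monoid -> K0monoid) x.

Fact K0actD h x y : K0act h (gcD x y) = gcD (K0act h x) (K0act h y).
Proof. exact/gc_mapD/K0shiftD. Qed.
Fact K0act1 x : K0act 1%g x = x.
Proof.
have [[p q] ->] := gc_ex x; rewrite /K0act gc_map_class; last exact: K0shiftD.
by rewrite /= !K0shift1.
Qed.
Fact K0actM g h x : K0act (g * h)%g x = K0act g (K0act h x).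
Proof.
have [[p q] ->] := gc_ex x; rewrite /K0act !gc_map_class; try exact: K0shiftD.
by rewrite /= !K0shiftM.
Qed.

(* The positive cone is the image of the monoid of isomorphism classes in its
   group completion. *)
Definition K0 : triple H :=
  @Triple H K0gc (gc0 K0monoid) (@gcN K0monoid) (@gcD K0monoid) K0act
    (fun x => exists P : fgproj, x = gc_of (K0class P : K0monoid))
    (gc_of (K0class fg_regular : K0monoid))
    (@gcDA K0monoid) (@gcDC K0monoid) (@gc0D K0monoid) (@gcND K0monoid)
    K0actD K0act1 K0actM.
End GradedK0.

Section QuotientGroup.
Variables (gT : finGroupType) (T : {group gT}).
Hypothesis abG : abelian [set: gT].

Lemma norm_abelian x : x \in 'N(T)%g.
Proof. by apply: (fintype.subsetP (sub_abelian_norm abG (finset.subsetT T))); rewrite inE. Qed.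

Lemma coset_morph : {morph coset T : x y / (x * y)%g}.
Proof. by move=> x y; rewrite morphM ?norm_abelian. Qed.

Lemma abelian_coset : abelian [set: coset_of T].
Proof.
apply/centsP => x _ y _; case: (cosetP x) => a _ ->; case: (cosetP y) => b _ ->.
have /centsP/(_ a (finset.in_setT a) b (finset.in_setT b)) c := abG.
by rewrite /commute -!coset_morph c.
Qed.
End QuotientGroup.

(* Main.v *)
Require Import Defs.
From HB Require Import structures.
From mathcomp Require Import all_boot all_order all_algebra all_fingroup.
From mathcomp Require Import boolp.

Set Implicit Arguments.
Unset Strict Implicit.
Unset Printing Implicit Defensive.

Import GRing.Theory.
Local Open Scope ring_scope.

(** The idea.  Both sides are computed from the same combinatorial data, so no
    functor between the two categories of modules is needed.

    Write [A] as the union of the images of matrix algebras [M_k] with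
    elementary gradings ([tower_of_limit]), and let [e_k] be the image of the
    matrix unit [E_00] of [M_k].  Let [B] be either [A (x) D], graded by [G],
    or [A] with its grading coarsened to [G/T].  In both cases [B] contains
    [A], with degrees pushed along a surjection [beta] from [G], and is spanned
    by the products of [A] with a graded-division algebra that centralizes it:
    [1 (x) D] in the first case, the scalars in the second.  In both cases
    [beta g] is a degree of that graded-division algebra exactly when [g] is in
    [T].  The record [model] states what the two algebras have in common, and
    everything is proved for a model.

    In a model, every finitely generated projective graded module is a direct
    sum of shifts of [B e_k], for some [k] ([has_basis_fgproj]): it is the
    image of a homogeneous idempotent matrix over [B], whose finitely many
    entries come from one [M_k], and cutting by [E_00] leaves an idempotent
    matrix over a graded-division algebra, where linear algebra works
    ([coord_reduction]).  Such a decomposition is recorded by [k] and a finite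
    family [d] of elements of [G].  Passing from [k] to a larger [l] multiplies
    the family by a finite family that is read off in [M_l] and so does not
    depend on the model ([refinement_exists], [dual_basis_stage]).  If [d] and
    [d'] both describe the same module at [k], then at some larger [l] the
    transition matrices between the two decompositions have entries in [e_l D],
    and inverse homogeneous matrices over a graded-division algebra match rows
    with columns modulo its support ([homog_invertible_bij], [two_bases]).
    Conversely a shift by an element of [T] does not change the isomorphism
    class of [B e_k], because [D] has a homogeneous unit of that degree
    ([has_basis_coset]).  Hence whether two families describe isomorphic
    modules is decided by the tower and by [T] alone.

    A graded [A (x) D]-module and a [G/T]-graded [A]-module correspond when
    they are described by the same pair [(k, d)].  This relation is total on
    both sides, respects and reflects isomorphism, and is compatible with
    direct sums, shifts and the regular modules, so that it induces the
    isomorphism of triples ([K0_iso_of_correspondence]). *)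

(** * Homogeneous elements *)

Section Homogeneous.
Variables (F : fieldType) (H : finGroupType) (A : algType F) (gA : grading H A).

Lemma gproj_id h x : gA h x -> gproj gA h x = x.
Proof. by move=> hx; rewrite (gprojE _ hx) eqxx. Qed.

Lemma homog_eq0 g h x : gA g x -> gA h x -> g != h -> x = 0.
Proof. by move=> gx hx /negPf gh; rewrite -[LHS](gproj_id hx) (gprojE _ gx) gh. Qed.

Lemma homogD h x y : gA h x -> gA h y -> gA h (x + y).
Proof. by apply: subgroupD; apply: homog_subgroup. Qed.

Lemma homog1 : gA 1%g 1.
Proof.
suff -> : 1 = gproj gA 1%g 1 by apply: gprojC.
rewrite -[RHS]mulr1 [X in _ = _ * X](gprojS gA) [LHS](gprojS gA) mulr_sumr.
apply: eq_bigr => h _; rewrite -[LHS]mul1r.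
rewrite -[LHS](@gproj_id h); last first.
  by rewrite mul1r; apply: gprojC.
rewrite [X in X * _](gprojS gA) mulr_suml gproj_sum (bigD1 1%g) //=.
rewrite gproj_id; last by rewrite -{1}[h]mul1g; apply: homogM; apply: gprojC.
rewrite big1 ?addr0 // => k k1.
rewrite (gprojE _ (homogM (gprojC gA k 1) (gprojC gA h 1))).
by case: eqP => // /eqP; rewrite -{2}[h]mul1g (inj_eq (mulIg _)) (negPf k1).
Qed.

Lemma gprojMl g h b x : gA g b -> gproj gA (g * h)%g (b * x) = b * gproj gA h x.
Proof.
move=> gb; rewrite {1}[x](gprojS gA) mulr_sumr gproj_sum (bigD1 h) //=.
rewrite (gproj_id (homogM gb (gprojC gA h x))) big1 ?addr0 // => k kh.
by rewrite (gprojE _ (homogM gb (gprojC gA k x))) (inj_eq (mulgI _)) (negPf kh).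
Qed.

Lemma gprojMr g h b x : gA g b -> gproj gA (h * g)%g (x * b) = gproj gA h x * b.
Proof.
move=> gb; rewrite {1}[x](gprojS gA) mulr_suml gproj_sum (bigD1 h) //=.
rewrite (gproj_id (homogM (gprojC gA h x) gb)) big1 ?addr0 // => k kh.
by rewrite (gprojE _ (homogM (gprojC gA k x) gb)) (inj_eq (mulIg _)) (negPf kh).
Qed.

End Homogeneous.

Lemma gproj_hom (F : fieldType) (H : finGroupType) (A B : algType F)
    (gA : grading H A) (gB : grading H B) (f : {lrmorphism A -> B}) : graded_hom gA gB f ->
  forall h x, gproj gB h (f x) = f (gproj gA h x).
Proof.
move=> hf h x; rewrite {1}[x](gprojS gA) rmorph_sum gproj_sum (bigD1 h) //=.
rewrite gproj_id; last by apply: hf; apply: gprojC.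
rewrite big1 ?addr0 // => k kh; rewrite (gprojE _ (hf _ _ (gprojC gA k x))).
by rewrite (negPf kh).
Qed.

(** * Graded algebras as unions of matrix algebras *)

Section Subalgebra.
Variables (F : fieldType) (H : finGroupType) (A : algType F) (gA : grading H A).
Variables (S : {pred A}) (S1 : 1 \in S)
  (SP : forall c x y, x \in S -> y \in S -> c *: x + y \in S)
  (SM : forall x y, x \in S -> y \in S -> x * y \in S)
  (Sproj : forall h x, x \in S -> gproj gA h x \in S).

Fact subalg_closedS : subalg_closed S.
Proof. by split. Qed.
HB.instance Definition _ := GRing.isSubalgClosed.Build F A S subalg_closedS.

(** The closure proofs are recorded in the type, since the algebra structure on
    it depends on them and could not be inferred from [S] alone. *)
Definition subalg : Type :=
  let _ := (S1, SP, SM) in {x | x \in S}.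
HB.instance Definition _ := SubChoice.copy subalg {x | x \in S}.
HB.instance Definition _ := [SubChoice_isSubAlgebra of subalg by <:].

Definition sub_homog (h : H) (x : subalg) : Prop := gA h (val x).

Fact sub_subspace h : sub_homog h 0 /\
  forall (c : F) x y, sub_homog h x -> sub_homog h y -> sub_homog h (c *: x + y).
Proof.
split=> [|c x y hx hy]; first exact: homog0.
exact: homogP.
Qed.

Fact sub_sum : is_direct_sum sub_homog.
Proof.
apply: (is_direct_sum_proj
  (pr := fun h x => (exist _ (gproj gA h (val x)) (Sproj h (valP x)) : subalg))).
- by move=> h x; apply: gprojC.
- move=> x; apply: val_inj; rewrite raddf_sum; exact: gprojS.
- by move=> h x y; apply: val_inj; apply: gprojD.
move=> g h x gx; apply: val_inj => /=; rewrite (gprojE _ gx); by case: eqP.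
Qed.

Fact subM g h x y : sub_homog g x -> sub_homog h y -> sub_homog (g * h)%g (x * y).
Proof. exact: homogM. Qed.

Definition subgrading : grading H (subalg : algType F) :=
  Grading sub_subspace sub_sum subM.

Lemma subalg_factor (M : algType F) (f : {lrmorphism M -> A}) :
  (forall x, f x \in S) ->
  exists f' : {lrmorphism M -> subalg}, forall x, val (f' x) = f x.
Proof.
move=> fS; pose f0 x : subalg := exist _ (f x) (fS x).
have f0l : linear f0 by move=> c x y; apply: val_inj; rewrite /= linearP.
have f0m : GRing.monoid_morphism f0.
  by split=> [|x y]; apply: val_inj; rewrite /= (rmorph1, rmorphM).
pose f' : {lrmorphism M -> subalg} :=
  HB.pack f0 (GRing.isLinear.Build _ _ _ _ f0 f0l) (GRing.isMonoidMorphism.Build _ _ f0 f0m).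
by exists f'.
Qed.

Lemma subalg_incl : exists v : {lrmorphism subalg -> A}, v =1 val.
Proof.
have vl : linear (val : subalg -> A) by [].
have vm : GRing.monoid_morphism (val : subalg -> A) by [].
pose v : {lrmorphism subalg -> A} :=
  HB.pack (val : subalg -> A) (GRing.isLinear.Build _ _ _ _ (val : subalg -> A) vl)
    (GRing.isMonoidMorphism.Build _ _ (val : subalg -> A) vm).
by exists v.
Qed.

End Subalgebra.

Section Tower.
Variables (F : fieldType) (G : finGroupType).

(** What is used of a direct limit of elementary matrix algebras.  Any two
    stages have images contained in one another, whence the lifting field. *)
Record tower (A : algType F) (gA : grading G A) := Tower {
  tw_n : nat -> nat;
  tw_gr : forall i, grading G 'M[F]_((tw_n i).+1);
  tw_map : forall i, {lrmorphism 'M[F]_((tw_n i).+1) -> A};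
  tw_deg : forall i, 'I_((tw_n i).+1) -> G;
  tw_elem : forall i a b, tw_gr i (tw_deg a * (tw_deg b)^-1)%g (delta_mx a b);
  tw_hom : forall i, graded_hom (tw_gr i) gA (tw_map i);
  tw_lift : forall i j g x, (i <= j)%N -> tw_gr i g x ->
    exists2 y, tw_gr j g y & tw_map j y = tw_map i x;
  tw_cover : forall g a, gA g a -> exists i, exists2 x, tw_gr i g x & tw_map i x = a }.

(** The union of the images is a graded subalgebra.  The universal property
    gives a retraction of [A] onto it, and composed with the inclusion this is
    the identity by uniqueness; so the union is all of [A]. *)
Lemma tower_of_limit (A : algType F) (gA : grading G A) :
  limit_of_elementary gA -> exists tw : tower gA, True.
Proof.
move=> [n [gM [f [phi [elM fH _ [phiH phif univ]]]]]].
have lift i j g x : (i <= j)%N -> gM i g x -> exists2 y, gM j g y & phi j y = phi i x.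
  move=> ij gx; rewrite -(subnK ij); elim: (j - i)%N => [|m [y gy yE]]; first by exists x.
  by exists (f _ y); [exact: fH | exact: etrans (phif _ _) yE].
have lift' i j x : (i <= j)%N -> exists y, phi j y = phi i x.
  move=> ij; rewrite -(subnK ij); elim: (j - i)%N => [|m [y yE]]; first by exists x.
  by exists (f _ y); apply: etrans (phif _ _) yE.
pose S : {pred A} := fun a => `[< exists i x, phi i x = a >].
have S1 : 1 \in S by apply/asboolP; exists 0%N, 1; rewrite rmorph1.
have S2 x y : x \in S -> y \in S -> exists k x' y', phi k x' = x /\ phi k y' = y.
  move=> /asboolP[i [x0 <-]] /asboolP[j [y0 <-]].
  have [x1 x1E] := lift' _ _ x0 (leq_maxl i j).
  have [y1 y1E] := lift' _ _ y0 (leq_maxr i j).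
  by exists (maxn i j), x1, y1.
have SP c x y : x \in S -> y \in S -> c *: x + y \in S.
  move=> xS yS; have [k [x' [y' [<- <-]]]] := S2 _ _ xS yS.
  by apply/asboolP; exists k, (c *: x' + y'); rewrite linearP.
have SM x y : x \in S -> y \in S -> x * y \in S.
  move=> xS yS; have [k [x' [y' [<- <-]]]] := S2 _ _ xS yS.
  by apply/asboolP; exists k, (x' * y'); rewrite rmorphM.
have Sproj h x : x \in S -> gproj gA h x \in S.
  move=> /asboolP[i [x' <-]]; apply/asboolP; exists i, (gproj (gM i) h x').
  by rewrite (gproj_hom (phiH i)).
have phiS i x : phi i x \in S by apply/asboolP; exists i, x.
have [psi psiE] : exists psi : forall i, {lrmorphism 'M[F]_((n i).+1) -> subalg S1 SP SM},
    forall i x, val (psi i x) = phi i x.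
  exists (fun i => projT1 (cid (subalg_factor S1 SP SM (phiS i)))).
  by move=> i; case: cid.
have [v vE] := subalg_incl S1 SP SM.
have [|i x|u [uH uE] _] := univ _ (subgrading S1 SP SM Sproj) psi.
- by move=> i h x hx; rewrite /= /sub_homog psiE; apply: phiH.
- by apply: val_inj; rewrite !psiE phif.
have [u0 _ u0U] := univ _ gA phi phiH phif.
(* Composed with the inclusion, [u] solves the same problem as the identity. *)
have AS a : a \in S.
  have vul : linear (fun a => v (u a)) by move=> c x y; rewrite !linearP.
  have vum : GRing.monoid_morphism (fun a => v (u a)).
    by split=> [|x y]; rewrite (rmorph1, rmorphM) (rmorph1, rmorphM).
  pose vu : {lrmorphism A -> A} := HB.pack (fun a => v (u a))
    (GRing.isLinear.Build _ _ _ _ _ vul) (GRing.isMonoidMorphism.Build _ _ _ vum).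
  have e1 : vu =1 u0.
    apply: u0U => [h x hx|i x]; first by rewrite /vu /= vE; exact: uH.
    by rewrite /vu /= vE uE psiE.
  have e2 : idfun =1 u0 :> (A -> A) by apply: (u0U idfun).
  by rewrite -[a]/(idfun a) e2 -e1 /vu /= vE; apply: valP.
have cover g a : gA g a -> exists i, exists2 x, gM i g x & phi i x = a.
  move=> ga; have /asboolP[i [x xE]] := AS a; exists i, (gproj (gM i) g x).
    exact: gprojC.
  by rewrite -(gproj_hom (phiH i)) xE gproj_id.
by exists (@Tower A gA n gM phi (fun i => projT1 (cid (elM i)))
  (fun i => projT2 (cid (elM i))) phiH lift cover).
Qed.
End Tower.

Arguments tw_deg {F G A gA} t i _.

(** * Bases adapted to an idempotent *)

Section Bases.
Variables (F : fieldType) (H : finGroupType) (B : algType F) (gB : grading H B).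

(** An isomorphism of [P] with the direct sum of the shifts by [dg i] of the
    module [B e], in coordinates: [q i] is the image of [e] in the summand [i],
    and [tau i], the projection to this summand, takes its values in [B e].
    For [e = 1] this is a homogeneous basis in the usual sense. *)
Record dual_basis (P : fgproj gB) (e : B) (I : finType) (dg : I -> H)
    (q : I -> P) (tau : I -> P -> B) : Prop := DualBasis {
  db_lin : forall i, linear (tau i : P -> B^o);
  db_hom : forall i, fg_homog (dg i) (q i);
  db_thom : forall i h x, fg_homog h x -> gB (h * (dg i)^-1)%g (tau i x);
  db_q : forall i, e *: q i = q i;
  db_tau : forall i x, tau i x * e = tau i x;
  db_sum : forall x, \sum_i tau i x *: q i = x;
  db_dual : forall i j, tau i (q j) = if i == j then e else 0 }.

Definition has_basis (P : fgproj gB) (e : B) (I : finType) (dg : I -> H) : Prop :=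
  exists q tau, @dual_basis P e I dg q tau.

Lemma fg_homog_sum (P : fgproj gB) h (J : Type) (r : seq J) (Q : pred J) (u : J -> P) :
  (forall i, Q i -> fg_homog h (u i)) -> fg_homog h (\sum_(i <- r | Q i) u i).
Proof. by apply: subgroup_sum; apply: fg_subgroup. Qed.

Section Coordinates.
Variables (P : fgproj gB) (f : P -> B) (fl : linear (f : P -> B^o)).
Lemma coordD x y : f (x + y) = f x + f y.
Proof. exact: (linearD (mklinear fl : {linear P -> B^o})). Qed.
Lemma coordZ b x : f (b *: x) = b * f x.
Proof. exact: (linearZ_LR (mklinear fl : {linear P -> B^o})). Qed.
Lemma coord_sum (J : Type) (r : seq J) (Q : pred J) (u : J -> P) :
  f (\sum_(i <- r | Q i) u i) = \sum_(i <- r | Q i) f (u i).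
Proof. exact: (linear_sum (mklinear fl : {linear P -> B^o})). Qed.
End Coordinates.

Lemma has_basis_iso P Q e (I : finType) (dg : I -> H) :
  has_basis P e dg -> has_basis Q e dg -> fg_iso P Q.
Proof.
move=> [p [s bP]] [q [t bQ]].
have lin (P' Q' : fgproj gB) (s' : I -> P' -> B) (q' : I -> Q') :
    (forall i, linear (s' i : P' -> B^o)) -> linear (fun x => \sum_i s' i x *: q' i).
  move=> sl c x y; rewrite scaler_sumr -big_split; apply: eq_bigr => i _ /=.
  by rewrite (coordD (sl i)) (coordZ (sl i)) scalerDl scalerA.
have canc (P' Q' : fgproj gB) p' s' q' t' : @dual_basis P' e I dg p' s' ->
    @dual_basis Q' e I dg q' t' ->
    forall x : P', \sum_i t' i (\sum_j s' j x *: q' j) *: p' i = x.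
  move=> bP' bQ' x; rewrite -[RHS](db_sum bP'); apply: eq_bigr => i _.
  rewrite (coord_sum (db_lin bQ' i)) (bigD1 i) //= (coordZ (db_lin bQ' i)).
  rewrite (db_dual bQ') eqxx (db_tau bP') big1 ?addr0 // => j ji.
  by rewrite (coordZ (db_lin bQ' i)) (db_dual bQ') eq_sym (negPf ji) mulr0.
have homo (P' Q' : fgproj gB) p' s' q' t' : @dual_basis P' e I dg p' s' ->
    @dual_basis Q' e I dg q' t' ->
    forall h (x : P'), fg_homog h x -> fg_homog h (\sum_i s' i x *: q' i).
  move=> bP' bQ' h x hx; apply: fg_homog_sum => i _.
  rewrite -[h](mulgKV (dg i)); exact: (fg_act (db_thom bP' i hx) (db_hom bQ' i)).
exists (mklinear (lin _ _ s q (db_lin bP))); split.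
  exists (fun y => \sum_i t i y *: p i) => x /=.
    exact: (canc _ _ _ _ _ _ bP bQ).
  exact: (canc _ _ _ _ _ _ bQ bP).
move=> h x; split=> /= hx; first exact: (homo _ _ _ _ _ _ bP bQ).
by rewrite -(canc _ _ _ _ _ _ bP bQ x); apply: (homo _ _ _ _ _ _ bQ bP).
Qed.

Lemma has_basis_transport P Q e (I : finType) (dg : I -> H) :
  fg_iso P Q -> has_basis P e dg -> has_basis Q e dg.
Proof.
move=> /[dup] PQ [f [[g fg gf] fH]] [q [s b]]; exists (fun i => f (q i)), (fun i y => s i (g y)).
have gl : linear g by move=> c x y; apply: (can_inj fg); rewrite linearP !gf.
split.
- by move=> i c x y /=; rewrite gl (db_lin b).
- by move=> i; apply/fH/(db_hom b).
- by move=> i h x hx; apply: (db_thom b); apply/fH; rewrite gf.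
- by move=> i; rewrite -linearZ_LR (db_q b).
- by move=> i x; apply: (db_tau b).
- move=> x; rewrite -[RHS]gf -[in RHS](db_sum b (g x)) linear_sum.
  by apply: eq_bigr => i _; rewrite linearZ_LR.
- by move=> i j; rewrite fg (db_dual b).
Qed.

Lemma has_basis_oplus P Q e (I J : finType) (dg : I -> H) (dg' : J -> H) :
  has_basis P e dg -> has_basis Q e dg' ->
  has_basis (fg_oplus P Q) e (fun x : I + J => match x with inl i => dg i | inr j => dg' j end).
Proof.
move=> [p [s bP]] [q [t bQ]].
exists (fun x : I + J => match x with inl i => (p i, 0) | inr j => (0, q j) end).
exists (fun x : I + J => match x with
  inl i => fun z : P * Q => s i z.1 | inr j => fun z : P * Q => t j z.2 end).
have t0 j : t j 0 = 0 by rewrite -[X in t j X](scale0r 0) (coordZ (db_lin bQ j)) mul0r.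
have s0 j : s j 0 = 0 by rewrite -[X in s j X](scale0r 0) (coordZ (db_lin bP j)) mul0r.
split.
- by move=> [i|j] c x y; rewrite /= ?(db_lin bP) ?(db_lin bQ).
- move=> [i|j]; split=> /=; try exact: (fg_subgroup _ _).1.
    exact: (db_hom bP).
  exact: (db_hom bQ).
- by move=> [i|j] h x [x1 x2]; [apply: (db_thom bP) | apply: (db_thom bQ)].
- by move=> [i|j]; apply: pair_ext; rewrite /= ?scaler0 ?(db_q bP) ?(db_q bQ).
- by move=> [i|j] x; [apply: (db_tau bP) | apply: (db_tau bQ)].
- move=> x; rewrite big_sumType /=; apply: pair_ext => /=.
    rewrite !(big_morph (fun z : P * Q => z.1) (fun _ _ => erefl) erefl) /=.
    rewrite [X in _ + X]big1 => [|j _]; last by rewrite scaler0.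
    by rewrite addr0 (db_sum bP).
  rewrite !(big_morph (fun z : P * Q => z.2) (fun _ _ => erefl) erefl) /=.
  rewrite [X in X + _]big1 => [|j _]; last by rewrite scaler0.
  by rewrite add0r (db_sum bQ).
by move=> [i|j] [i'|j'] /=; rewrite ?t0 ?s0 ?(db_dual bP) ?(db_dual bQ).
Qed.

Lemma has_basis_shift P e (I : finType) (dg : I -> H) h :
  has_basis P e dg -> has_basis (fg_shift h P) e (fun i => (dg i * h)%g).
Proof.
move=> [q [s b]]; exists q, s; split.
- exact: (db_lin b).
- by move=> i; rewrite /= /shift_homog mulgK; apply: (db_hom b).
- move=> i k x; rewrite /= /shift_homog => hx.
  by rewrite invMg mulgA; apply: (db_thom b).
- exact: (db_q b).
- exact: (db_tau b).
- exact: (db_sum b).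
- exact: (db_dual b).
Qed.

End Bases.

(** Coordinates that recover every element exhibit [P] as a direct summand of a
    free module of finite rank. *)
Section DualBasisModules.
Variables (R : pzRingType) (P : lmodType R) (I : finType) (q : I -> P) (tau : I -> P -> R^o).
Hypotheses (tau_lin : forall i, linear (tau i)) (tau_sum : forall x, \sum_i (tau i x : R) *: q i = x).

Lemma finitely_generated_dual : finitely_generated P.
Proof.
exists #|I|, (fun k => q (enum_val k)) => x; exists (fun k => tau (enum_val k) x).
rewrite -[LHS]tau_sum (reindex (@enum_val I I)) //=.
by apply: onW_bij; apply: enum_val_bij.
Qed.

Lemma projective_dual : projective P.
Proof.
move=> M N p f ps.
have [m mE] : exists m : I -> M, forall i, p (m i) = f (q i).
  by exists (fun i => projT1 (cid (ps (f (q i))))) => i; case: cid.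
have gl : linear (fun x => \sum_i (tau i x : R) *: m i).
  move=> c x y; rewrite scaler_sumr -big_split; apply: eq_bigr => i _ /=.
  by rewrite tau_lin scalerDl scalerA.
exists (mklinear gl) => x /=; rewrite -[in RHS](tau_sum x) !linear_sum.
by apply: eq_bigr => i _; rewrite !linearZ_LR mE.
Qed.
End DualBasisModules.

(** The direct sum of the shifts by [dg i] of [B e], realized as the families
    [f] with [f i] in [B e]. *)
Section Free.
Variables (F : fieldType) (H : finGroupType) (B : algType F) (gB : grading H B).

Variables (e : B) (ee : e * e = e) (e1 : gB 1%g e) (I : finType) (dg : I -> H).

Definition free_pred : {pred {ffun I -> B^o}} := fun f => [forall i, f i * e == f i].
Lemma free_predP (f : {ffun I -> B^o}) : reflect (forall i, f i * e = f i) (f \in free_pred).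
Proof. exact: 'forall_eqP. Qed.
Fact free_pred_closed : submod_closed free_pred.
Proof.
split=> [|c f g /free_predP hf /free_predP hg]; apply/free_predP => i; first by rewrite ffunE mul0r.
by rewrite !ffunE mulrDl -scalerAl hf hg.
Qed.
HB.instance Definition _ := GRing.isSubmodClosed.Build B {ffun I -> B^o} free_pred free_pred_closed.

Definition free_module : Type := {f | f \in free_pred}.
HB.instance Definition _ := SubChoice.on free_module.
HB.instance Definition _ := [SubChoice_isSubLmodule of free_module by <:].

Definition free_coord (i : I) (f : free_module) : B^o := val f i.
Fact free_coord_lin i : linear (free_coord i).
Proof. by move=> c f g; rewrite /free_coord /= !ffunE. Qed.

Fact free_gen_subproof (i : I) : [ffun j => if i == j then e else 0] \in free_pred.
Proof. by apply/free_predP => j; rewrite ffunE; case: ifP; rewrite ?mul0r. Qed.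
Definition free_gen i : free_module := exist (fun f => f \in free_pred) _ (free_gen_subproof i).

Fact free_sumE (J : Type) (r : seq J) (Q : pred J) (u : J -> free_module) i :
  val (\sum_(j <- r | Q j) u j) i = \sum_(j <- r | Q j) val (u j) i.
Proof. by rewrite raddf_sum sum_ffunE. Qed.

Fact free_coord_sum f : \sum_i (free_coord i f : B) *: free_gen i = f.
Proof.
apply: val_inj; apply/ffunP => i; rewrite free_sumE (bigD1 i) //=.
rewrite !ffunE eqxx big1 ?addr0 => [|j ji]; last first.
  by rewrite !ffunE (negPf ji) scaler0.
exact/free_predP/(valP f).
Qed.

Definition free_homog (h : H) (f : free_module) : Prop :=
  forall i, gB (h * (dg i)^-1)%g (free_coord i f).

Fact free_subgroup h : is_subgroup (free_homog h).
Proof.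
split=> [i|x y hx hy i]; first by rewrite /free_coord ffunE; apply: homog0.
by rewrite /free_coord /= !ffunE; apply: (homog_subgroup _ _).2.
Qed.

Fact free_proj_subproof h (f : free_module) :
  [ffun i => gproj gB (h * (dg i)^-1)%g (val f i)] \in free_pred.
Proof.
apply/free_predP => i; rewrite ffunE -(gprojMr _ _ e1) mulg1; congr gproj.
exact/free_predP/(valP f).
Qed.

Fact free_dsum : is_direct_sum free_homog.
Proof.
apply: (is_direct_sum_proj (pr := fun h f =>
  (exist (fun f => f \in free_pred) _ (free_proj_subproof h f) : free_module))).
- by move=> h f i; rewrite /free_coord ffunE; apply: gprojC.
- move=> f; apply: val_inj; apply/ffunP => i; rewrite free_sumE.
  rewrite [LHS](gprojS gB) (reindex_inj (mulIg (dg i)^-1%g)).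
  by apply: eq_bigr => h _; rewrite /= ffunE.
- by move=> h f g; apply: val_inj; apply/ffunP => i; rewrite /= !ffunE gprojD.
move=> g h f gf; apply: val_inj; apply/ffunP => i; rewrite /= ffunE (gprojE _ (gf i)).
by rewrite (inj_eq (mulIg _)); case: eqP => // _; rewrite ffunE.
Qed.

Fact free_act g h b x : gB g b -> free_homog h x -> free_homog (g * h)%g (b *: x).
Proof. by move=> gb hx i; rewrite /free_coord /= ffunE -mulgA; apply: homogM. Qed.

Definition fg_free : fgproj gB :=
  FGProj free_subgroup free_dsum free_act
    (finitely_generated_dual free_coord_sum) (projective_dual free_coord_lin free_coord_sum).

Lemma has_basis_free : has_basis fg_free e dg.
Proof.
exists free_gen, free_coord; split.
- exact: free_coord_lin.
- move=> i j; rewrite /free_coord /= ffunE; case: eqP => [->|_]; last exact: homog0.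
  by rewrite mulgV.
- by move=> i h x; apply.
- by move=> i; apply: val_inj; apply/ffunP => j; rewrite /= !ffunE; case: ifP => _;
    rewrite ?scaler0 // /GRing.scale /= ee.
- by move=> i x; apply/free_predP/(valP x).
- exact: free_coord_sum.
- by move=> i j; rewrite /free_coord /= ffunE eq_sym.
Qed.
End Free.

Section ChangeOfBasis.
Variables (F : fieldType) (H : finGroupType) (B : algType F) (gB : grading H B).

Lemma has_basis_regular : has_basis (fg_regular gB) 1 (fun _ : unit => 1%g).
Proof.
exists (fun=> 1), (fun _ x => x); split=> //.
- by move=> _; apply: homog1.
- by move=> _ h x; rewrite invg1 mulg1.
- by move=> _; apply: mulr1.
- by move=> _; apply: mulr1.
- by move=> x; rewrite big_const card_unit /= addr0; apply: mulr1.
Qed.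

(** The relations say that the rows [y l] and the columns [x l] identify the
    module [B e] with a sum of shifts of [B e']; each summand [B e] of [P] is
    split accordingly. *)
Lemma dual_basis_refine P e e' (I L : finType) (dg : I -> H) (r : L -> H) (x y : L -> B) q s :
    \sum_l x l * y l = e -> (forall k l, y k * x l = if k == l then e' else 0) ->
    (forall l, e' * y l = y l) -> (forall l, x l * e' = x l) ->
    (forall l, gB (r l) (y l)) -> (forall l, gB (r l)^-1%g (x l)) ->
  dual_basis (gB := gB) (P := P) e dg q s ->
  dual_basis e' (fun z : L * I => (r z.1 * dg z.2)%g)
    (fun z => y z.1 *: q z.2) (fun z p => s z.2 p * x z.1).
Proof.
move=> xy yx ey xe hy hx b.
have ex l : e * x l = x l.
  rewrite -xy mulr_suml (bigD1 l) //= -mulrA yx eqxx xe big1 ?addr0 // => k kl.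
  by rewrite -mulrA yx (negPf kl) mulr0.
split.
- move=> i c p p' /=; rewrite (coordD (db_lin b _)) (coordZ (db_lin b _)) mulrDl.
  by rewrite -mulrA.
- by move=> [l i] /=; apply: fg_act => //; apply: (db_hom b).
- move=> [l i] h p hp /=; rewrite invMg mulgA; apply: homogM => //.
  exact: (db_thom b).
- by move=> [l i] /=; rewrite scalerA ey.
- by move=> [l i] p /=; rewrite -mulrA xe.
- move=> p; rewrite -(pair_bigA _ (fun l i => (s i p * x l) *: (y l *: q i))) exchange_big /=.
  rewrite -[RHS](db_sum b); apply: eq_bigr => i _.
  under eq_bigr do rewrite scalerA -mulrA.
  by rewrite -scaler_suml -mulr_sumr xy (db_tau b).
move=> [l i] [l' i'] /=; rewrite (coordZ (db_lin b _)) (db_dual b) xpair_eqE.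
case: (i =P i') => [_|_]; last by rewrite andbF mulr0 mul0r.
by rewrite andbT -mulrA ex yx eq_sym.
Qed.

(** A unit commuting with [e] moves each [q i] to another degree without
    changing the module that it generates. *)
Lemma has_basis_twist P e (I J : finType) (dg : I -> H) (dg' : J -> H) (h : J -> I) :
    bijective h ->
    (forall j, exists w w', [/\ gB (dg' j * (dg (h j))^-1)%g w,
       gB (dg (h j) * (dg' j)^-1)%g w', w * w' = 1, w' * w = 1 & w * e = e * w]) ->
  has_basis (gB := gB) P e dg -> has_basis P e dg'.
Proof.
move=> [h' hK h'K] W [q [s b]].
have [w [w' ww]] : exists w w' : J -> B, forall j, [/\ gB (dg' j * (dg (h j))^-1)%g (w j),
       gB (dg (h j) * (dg' j)^-1)%g (w' j), w j * w' j = 1, w' j * w j = 1 & w j * e = e * w j].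
  exists (fun j => projT1 (cid (W j))), (fun j => projT1 (cid (projT2 (cid (W j))))).
  by move=> j; case: cid => ? W' /=; case: cid.
exists (fun j => w j *: q (h j)), (fun j x => s (h j) x * w' j); split.
- move=> i c p p' /=; rewrite (coordD (db_lin b _)) (coordZ (db_lin b _)) mulrDl.
  by rewrite -mulrA.
- move=> j; rewrite -(mulgKV (dg (h j)) (dg' j)); apply: fg_act.
    by case: (ww j).
  exact: (db_hom b).
- move=> j k x kx; rewrite -[k](mulgKV (dg (h j))) -mulgA.
  apply: homogM; last by case: (ww j).
  exact: (db_thom b).
- by move=> j; case: (ww j) => _ _ _ _ we; rewrite scalerA -we -scalerA (db_q b).
- move=> j x; case: (ww j) => _ _ w1 w2 we.
  have we' : w' j * e = e * w' j.
    by rewrite -[e in LHS]mulr1 -w1 !mulrA -(mulrA (w' j)) -we mulrA w2 mul1r.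
  by rewrite -mulrA we' mulrA (db_tau b).
- move=> x; rewrite -[RHS](db_sum b) [RHS](reindex h) /=; last first.
    by exists h' => ? _; [apply: hK | apply: h'K].
  apply: eq_bigr => j _; case: (ww j) => _ _ _ w2 _.
  by rewrite scalerA -mulrA w2 mulr1.
move=> i j; rewrite (coordZ (db_lin b _)) (db_dual b) (can_eq hK).
case: eqP => [->|_]; last by rewrite mulr0 mul0r.
by case: (ww j) => _ _ w1 _ we; rewrite we -mulrA w1 mulr1.
Qed.

End ChangeOfBasis.

(** * Linear algebra over a graded-division algebra *)

Section GradedDivision.
Variables (F : fieldType) (H : finGroupType) (B : algType F) (gB : grading H B).

(** A graded-division subalgebra, given by its components only: nothing in the
    sequel mentions its nonhomogeneous elements. *)
Record gdiv (D : H -> B -> Prop) : Prop := GDiv {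
  gd_hom : forall h x, D h x -> gB h x;
  gd0 : forall h, D h 0;
  gdP : forall h (c : F) x y, D h x -> D h y -> D h (c *: x + y);
  gd1 : D 1%g 1;
  gdM : forall g h x y, D g x -> D h y -> D (g * h)%g (x * y);
  gdV : forall h x, D h x -> x <> 0 -> exists2 y, D h^-1%g y & x * y = 1 /\ y * x = 1 }.

Variables (D : H -> B -> Prop) (gdD : gdiv D).

Lemma gd_add h x y : D h x -> D h y -> D h (x + y).
Proof. by move=> hx hy; rewrite -[x]scale1r; apply: gdP. Qed.
Lemma gd_scale h c x : D h x -> D h (c *: x).
Proof. by move=> hx; rewrite -[_ *: _]addr0; apply: gdP => //; apply: gd0. Qed.
Lemma gd_sub h x y : D h x -> D h y -> D h (x - y).
Proof. by move=> hx hy; rewrite addrC -scaleN1r; apply: gdP. Qed.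

Section Elimination.
Variables (I J : finType) (dg : I -> H) (dg' : J -> H).

(** If [u v = 1] for a homogeneous matrix [u], then every row of [u] can be
    given its own column, in such a way that [D] has a nonzero element of the
    degree of the entry where they meet.  A row of [u] has a nonzero entry; it is a pivot, and the
    Schur complement is again right invertible, with the corresponding block
    of [v] as inverse. *)
Lemma homog_elimination (j0 : J) n (A : {set I}) (A' : {set J}) (u : I -> J -> B) (v : J -> I -> B) :
    #|A| = n ->
    (forall a b, D (dg a * (dg' b)^-1)%g (u a b)) ->
    (forall a c, a \in A -> c \in A ->
       \sum_(b in A') u a b * v b c = if a == c then 1 else 0) ->
  exists h : I -> J, {in A &, injective h} /\
    forall a, a \in A -> h a \in A' /\ exists2 w, D (dg a * (dg' (h a))^-1)%g w & w <> 0.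
Proof.
elim: n A A' u => [|n IHn] A A' u cA Du uv.
  by exists (fun=> j0); have -> : A = finset.set0 by [apply/eqP; rewrite -finset.cards_eq0 cA];
    split=> [x y|a]; rewrite inE.
have [a0 a0A] : exists a0, a0 \in A by apply/finset.set0Pn; rewrite -finset.card_gt0 cA.
have [b0 b0A u0] : exists2 b0, b0 \in A' & u a0 b0 <> 0.
  apply: contrapT => nb; have := uv _ _ a0A a0A; rewrite eqxx big1 => [|b bA].
    by move/esym/eqP; rewrite oner_eq0.
  by have [->|/eqP ub] := eqVneq (u a0 b) 0; [rewrite mul0r | case: nb; exists b].
have [y Dy [uy yu]] := gdV gdD (Du a0 b0) u0.
pose u' a b := u a b - u a b0 * y * u a0 b.
have Du' a b : D (dg a * (dg' b)^-1)%g (u' a b).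
  apply: gd_sub => //; have -> : (dg a * (dg' b)^-1 = (dg a * (dg' b0)^-1) *
    (dg a0 * (dg' b0)^-1)^-1 * (dg a0 * (dg' b)^-1))%g.
    by rewrite invMg invgK !mulgA !mulgKV.
  by do 2 apply: gdM => //.
have cA1 : #|A :\ a0| = n by apply: succn_inj; rewrite -cA (finset.cardsD1 a0 A) a0A.
have [|h [hinj hA]] := IHn (A :\ a0) (A' :\ b0) u' cA1 Du'.
  move=> a c; rewrite !inE => /andP[aa0 aA] /andP[ca0 cA2].
  have E a1 : a1 \in A -> \sum_(b in A' :\ b0) u a1 b * v b c =
      (if a1 == c then 1 else 0) - u a1 b0 * v b0 c.
    by move=> a1A; rewrite -uv // [in RHS](finset.big_setD1 b0) //= [RHS]addrC addKr.
  under eq_bigr => b _ do rewrite /u' mulrBl -!mulrA.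
  rewrite sumrB -!mulr_sumr !E // eq_sym [a0 == c]eq_sym (negPf ca0) sub0r.
  by rewrite !mulrN opprK (mulrA y) yu mul1r subrK eq_sym.
exists (fun a => if a == a0 then b0 else h a); split.
  move=> a a' aA a'A; case: eqVneq => [->|aa0]; case: eqVneq => [->|a'a0] // E.
  - have [|+ _] := hA a'; first by rewrite !inE a'a0.
    by rewrite -E !inE eqxx.
  - have [|+ _] := hA a; first by rewrite !inE aa0.
    by rewrite E !inE eqxx.
  by apply: hinj => //; rewrite !inE ?aa0 ?a'a0.
move=> a aA; case: eqVneq => [->|aa0]; first by split=> //; exists (u a0 b0).
have [|+ [w Dw w0]] := hA a; first by rewrite !inE aa0.
by rewrite !inE => /andP[_ ?]; split=> //; exists w.
Qed.

End Elimination.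

(** Elimination on both sides gives injections in both directions, so the
    first one is a bijection of finite sets. *)
Lemma homog_invertible_bij (I J : finType) (dg : I -> H) (dg' : J -> H)
    (u : I -> J -> B) (v : J -> I -> B) :
    (forall a b, D (dg a * (dg' b)^-1)%g (u a b)) ->
    (forall b a, D (dg' b * (dg a)^-1)%g (v b a)) ->
    (forall a c, \sum_b u a b * v b c = if a == c then 1 else 0) ->
    (forall b d, \sum_a v b a * u a d = if b == d then 1 else 0) ->
  exists2 h : I -> J, bijective h &
    forall a, exists2 w, D (dg a * (dg' (h a))^-1)%g w & w <> 0.
Proof.
have inj (I1 J1 : finType) (d1 : I1 -> H) (d1' : J1 -> H)
    (u1 : I1 -> J1 -> B) (v1 : J1 -> I1 -> B) :
    (forall a b, D (d1 a * (d1' b)^-1)%g (u1 a b)) ->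
    (forall a c, \sum_b u1 a b * v1 b c = if a == c then 1 else 0) ->
    exists2 h : I1 -> J1, injective h &
    forall a, exists2 w, D (d1 a * (d1' (h a))^-1)%g w & w <> 0.
  move=> Du1 uv1; have [j0 _|J0] := pickP (xpredT : pred J1).
    have [|h [hi hA]] := @homog_elimination _ _ _ _ j0 _ [set: I1] [set: J1] u1 v1 erefl Du1.
      by move=> a c _ _; rewrite -uv1; apply: eq_bigl => b; rewrite inE.
    exists h => [x y|a]; first by apply: hi; rewrite inE.
    by have [|_] := hA a; first by rewrite inE.
  have I0 : I1 -> False.
    move=> i; have := uv1 i i; rewrite eqxx big1 => [|b _]; last by have := J0 b.
    by move/esym/eqP; rewrite oner_eq0.
  by exists (fun i => False_rect J1 (I0 i)) => i; case: (I0 i).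
move=> Du Dv uv vu; have [h hi hw] := inj _ _ _ _ _ _ Du uv.
have [h' hi' _] := inj _ _ _ _ _ _ Dv vu.
exists h => //; apply: inj_card_bij => //; exact: leq_card hi'.
Qed.
End GradedDivision.

(** Choosing a basis among homogeneous generators [q].  The coordinate functions
    [tau] send generators to [D e] but need not be dual to them. *)
Section Reduction.
Variables (F : fieldType) (H : finGroupType) (B : algType F) (gB : grading H B).
Variables (D : H -> B -> Prop) (gdD : gdiv gB D).
Variables (P : fgproj gB) (e : B) (eD : forall h d, D h d -> d * e = e * d).
Variables (I : finType) (dg : I -> H) (q : I -> P) (eq_ : forall i, e *: q i = q i).

Record coord (A : {set I}) (tau : I -> P -> B) : Prop := Coord {
  co_lin : forall i, linear (tau i : P -> B^o);
  co_hom : forall i h x, fg_homog h x -> gB (h * (dg i)^-1)%g (tau i x);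
  co_tau : forall i x, tau i x * e = tau i x;
  co_q : forall k i, exists2 c, D (dg k * (dg i)^-1)%g c & tau i (q k) = c * e;
  co_fix : forall k, k \in A -> \sum_(i in A) tau i (q k) *: q i = q k }.

(** If the coordinates are not dual to the generators, then expanding some [q k]
    in two ways gives a homogeneous relation over [D] with a nonzero
    coefficient at some [q l0].  This coefficient is invertible, so [q l0] can
    be expressed by the other generators and dropped; its coordinate is
    distributed over theirs.  The operator [x |-> sum_i tau i x *: q i] is kept
    throughout.  It is the identity when a whole module is generated, but the
    splitting of an idempotent uses the case of a projection. *)
Lemma coord_reduction n (A : {set I}) tau : #|A| = n -> coord A tau ->
  exists (A' : {set I}) tau', [/\ coord A' tau',
    forall x, \sum_(i in A') tau' i x *: q i = \sum_(i in A) tau i x *: q i &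
    forall i k, i \in A' -> k \in A' -> tau' i (q k) = if i == k then e else 0].
Proof.
elim: n A tau => [|n IHn] A tau cA hA.
  exists A, tau; split=> // i k; suff -> : A = finset.set0 by rewrite inE.
  by apply/eqP; rewrite -finset.cards_eq0 cA.
have [E|/existsNP[l0 /existsNP[k /not_implyP[l0A /not_implyP[kA ne]]]]] :=
  pselect (forall i k, i \in A -> k \in A -> tau i (q k) = if i == k then e else 0); first by exists A, tau.
have [c cP] : exists c : I -> B, forall i, D (dg k * (dg i)^-1)%g (c i) /\ tau i (q k) = c i * e.
  exists (fun i => projT1 (cid2 (co_q hA k i))) => i; by case: cid2.
(* The relation [sum_i c' i *: q i = 0], with [c' l0] nonzero. *)
pose c' i := c i - (if i == k then 1 else 0).
have Dc' i : D (dg k * (dg i)^-1)%g (c' i).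
  apply: (gd_sub gdD); first by case: (cP i).
  by case: eqP => [->|_]; [rewrite mulgV; exact: (gd1 gdD) | exact: (gd0 gdD)].
have c'0 : \sum_(i in A) c' i *: q i = 0.
  under eq_bigr => i _ do rewrite scalerBl.
  have dE : \sum_(i in A) (if i == k then 1 else 0 : B) *: q i = q k.
    rewrite (bigD1 k) //= eqxx scale1r big1 ?addr0 //.
    by move=> i /andP[_ /negPf ->]; rewrite scale0r.
  rewrite sumrB dE -[X in _ - X](co_fix hA kA); apply/eqP; rewrite subr_eq0; apply/eqP.
  by apply: eq_bigr => i _; case: (cP i) => _ ->; rewrite -scalerA eq_.
have c'l0 : c' l0 <> 0.
  move=> c0; apply: ne; case: (cP l0) => _ ->.
  have -> : c l0 = (if l0 == k then 1 else 0) by apply/eqP; rewrite -subr_eq0 -/(c' l0) c0.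
  by case: ifP => _; rewrite ?mul1r ?mul0r.
have [y Dy [_ yc]] := gdV gdD (Dc' l0) c'l0.
(* Solved for [q l0]: its coefficients on the other generators. *)
pose w i := - (y * c' i).
have Dw i : D (dg l0 * (dg i)^-1)%g (w i).
  rewrite /w -scaleN1r; apply: (gd_scale gdD).
  have -> : (dg l0 * (dg i)^-1 = (dg k * (dg l0)^-1)^-1 * (dg k * (dg i)^-1))%g.
    by rewrite invMg invgK !mulgA !mulgKV.
  exact: (gdM gdD).
have wq : \sum_(i in A :\ l0) w i *: q i = q l0.
  have := congr1 (fun z => y *: z) c'0; rewrite scaler0 (finset.big_setD1 l0) //= scalerDr.
  rewrite scalerA yc scale1r => /eqP; rewrite addr_eq0 => /eqP ->.
  rewrite scaler_sumr -sumrN; apply: eq_bigr => i _.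
  by rewrite /w scalerA scaleNr.
pose tau' i x := tau i x + tau l0 x * w i.
have sumE x : \sum_(i in A :\ l0) tau' i x *: q i = \sum_(i in A) tau i x *: q i.
  rewrite [RHS](finset.big_setD1 l0) //= -wq scaler_sumr -big_split /=.
  by apply: eq_bigr => i _; rewrite scalerA -scalerDl addrC.
have cA' : #|A :\ l0| = n by apply: succn_inj; rewrite -cA (finset.cardsD1 l0 A) l0A.
have [|A' [t [h1 h2 h3]]] := IHn (A :\ l0) tau' cA'; last first.
  by exists A', t; split=> // x; rewrite h2 sumE.
split.
- move=> i b x x'; rewrite /tau' (coordD (co_lin hA i)) (coordZ (co_lin hA i)).
  rewrite (coordD (co_lin hA l0)) (coordZ (co_lin hA l0)).
  by rewrite mulrDl addrACA -mulrA -mulrDr.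
- move=> i h x hx; apply: homogD; first exact: (co_hom hA).
  rewrite -[h](mulgKV (dg l0)) -mulgA; apply: homogM; first exact: (co_hom hA).
  exact: (gd_hom gdD).
- move=> i x; rewrite mulrDl (co_tau hA) -mulrA (eD (Dw i)) mulrA (co_tau hA) //.
- move=> m i; have [a Da aE] := co_q hA m i; have [a' Da' a'E] := co_q hA m l0.
  exists (a + a' * w i); last by rewrite /tau' aE a'E mulrDl -!mulrA (eD (Dw i)).
  apply: (gd_add gdD) => //.
  have -> : (dg m * (dg i)^-1 = (dg m * (dg l0)^-1) * (dg l0 * (dg i)^-1))%g.
    by rewrite !mulgA mulgKV.
  exact: (gdM gdD).
by move=> m; rewrite !inE => /andP[_ mA]; rewrite sumE (co_fix hA).
Qed.

Lemma dual_reduction tau : coord [set: I] tau ->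
  exists (J : finType) (f : J -> I) (t : J -> P -> B),
  [/\ forall j, linear (t j : P -> B^o),
      forall j h x, fg_homog h x -> gB (h * (dg (f j))^-1)%g (t j x),
      forall j x, t j x * e = t j x,
      forall x, \sum_j t j x *: q (f j) = \sum_i tau i x *: q i &
      forall i j, t i (q (f j)) = if i == j then e else 0].
Proof.
move=> /(coord_reduction erefl)[A [t [tA sA dA]]].
exists {i | i \in A}, val, (fun j => t (val j)); split.
- by move=> j; apply: (co_lin tA).
- by move=> j; apply: (co_hom tA).
- by move=> j; apply: (co_tau tA).
- move=> x; rewrite -(big_sub A (fun i => t i x *: q i)) sA.
  by apply: eq_bigl => i; rewrite inE.
by move=> i j; rewrite dA ?(valP i) ?(valP j).
Qed.
End Reduction.

(** * Splitting the corner of one stage at a later stage *)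

Lemma mul_delta_delta (F : fieldType) n (i j k l : 'I_n.+1) (X : 'M[F]_n.+1) :
  delta_mx i j * X * delta_mx k l = X j k *: delta_mx i l.
Proof.
apply/matrixP => a b; rewrite !mxE (bigD1 k) //= big1 ?addr0; last first.
  by move=> c ck; rewrite [delta_mx _ _ c b]mxE (negPf ck) mulr0.
rewrite !mxE (bigD1 j) //= big1 ?addr0; last first.
  by move=> c cj; rewrite !mxE (negPf cj) andbF mul0r.
by rewrite !mxE !eqxx /= andbT -mulnb natrM mulrCA mulrA.
Qed.

Lemma mul_deltaE (F : fieldType) n (i j l : 'I_n.+1) :
  delta_mx i j * delta_mx j l = delta_mx i l :> 'M[F]_n.+1.
Proof. exact: mul_delta_mx. Qed.

Lemma one_sum_delta (F : fieldType) n : (1 : 'M[F]_n.+1) = \sum_i delta_mx i i.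
Proof. exact: mx1_sum_delta. Qed.

(** Matrix algebras are simple: if [X] has a nonzero entry and is sent to [0],
    then so are all the diagonal matrix units, hence [1]. *)
Lemma matrix_map_inj (F : fieldType) n (B : algType F) (f : {lrmorphism 'M[F]_n.+1 -> B}) :
  injective f.
Proof.
apply: raddf_inj => X fX; apply/matrixP => a b; rewrite mxE; apply: contrapT => /eqP Xab.
have f0 c : f (delta_mx c c) = 0.
  have := congr1 f (mul_delta_delta c a b c X); rewrite linearZ_LR !rmorphM fX mulr0 mul0r.
  by move/esym/eqP; rewrite scaler_eq0 (negPf Xab) => /eqP.
have := rmorph1 f; rewrite one_sum_delta raddf_sum big1 => [/esym/eqP|c _]; last exact: f0.
by rewrite oner_eq0.
Qed.

Section Scalars.
Variables (F : fieldType) (H : finGroupType) (B : algType F) (gB : grading H B).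

Definition scal (h : H) (b : B) : Prop := exists2 c : F, b = c%:A & h <> 1%g -> c = 0.

Lemma scal_gdiv : gdiv gB scal.
Proof.
split.
- move=> h _ [c -> hc]; have [->|/hc ->] := pselect (h = 1%g).
    by apply: homogZ; apply: homog1.
  by rewrite scale0r; apply: homog0.
- by move=> h; exists 0; rewrite ?scale0r.
- move=> h c _ _ [a -> ha] [b -> hb]; exists (c * a + b).
    by rewrite scalerA scalerDl.
  by move=> /[dup] /ha -> /hb ->; rewrite mulr0 addr0.
- by exists 1; rewrite ?scale1r.
- move=> g h _ _ [a -> ha] [b -> hb]; exists (a * b); first by rewrite -scalerAl mul1r scalerA.
  move=> gh; have [g1|/ha ->] := pselect (g = 1%g); last by rewrite mul0r.
  by rewrite hb ?mulr0 // => h1; apply: gh; rewrite g1 h1 mulg1.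
- move=> h _ [c -> hc] c0; have cn0 : c != 0.
    by apply/eqP => c1; apply: c0; rewrite c1 scale0r.
  exists (c^-1)%:A; first exists c^-1 => // h1.
    suff h2 : h <> 1%g by move: cn0; rewrite hc ?eqxx.
    by move=> h2; apply: h1; rewrite h2 invg1.
  by rewrite -!scalerAl !mul1r !scalerA mulfV // mulVf // scale1r.
Qed.

Lemma scal_comm h d b : scal h d -> d * b = b * d.
Proof. by move=> [c -> _]; rewrite -scalerAl -scalerAr mul1r mulr1. Qed.
End Scalars.

Section Refinement.
Variables (F : fieldType) (G : finGroupType) (A : algType F) (gA : grading G A).
Variable tw : tower gA.
Local Notation M i := 'M[F]_((tw_n tw i).+1).
Local Notation E00 := (delta_mx 0 0).

(** The module over [A] generated by the corner of stage [k] is a sum of shifts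
    of the one generated by the corner of stage [l].  The matrices that realize
    this live in stage [l] itself, which is what makes the shifts [r] common to
    all the models. *)
Record refinement (k l : nat) (L : finType) (r : L -> G) (x y : L -> M l) : Prop := Refinement {
  rf_sum : tw_map tw l (\sum_a x a * y a) = tw_map tw k E00;
  rf_dual : forall a b, y a * x b = if a == b then E00 else 0;
  rf_y : forall a, E00 * y a = y a;
  rf_x : forall a, x a * E00 = x a;
  rf_hy : forall a, tw_gr tw l (r a) (y a);
  rf_hx : forall a, tw_gr tw l (r a)^-1%g (x a) }.

(** The corner of stage [k] lifts to a homogeneous idempotent [Y] of degree [1]
    in stage [l].  The elements [E_0a Y] generate the left ideal of [Y], with
    coordinates [x |-> x Y E_a0] whose values on generators are scalar
    multiples of [E_00], so that the reduction over the scalars applies. *)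
Lemma refinement_exists k l : (k <= l)%N ->
  exists (L : finType) (r : L -> G) x y, @refinement k l L r x y.
Proof.
move=> kl.
have E1 : tw_gr tw k 1%g E00 by rewrite -(mulgV (tw_deg tw k 0)); apply: tw_elem.
have [Y Y1 YE] := tw_lift kl E1.
have YY : Y * Y = Y.
  apply: (@matrix_map_inj _ _ _ (tw_map tw l)); rewrite rmorphM /= !YE.
  exact: etrans (esym (rmorphM _ _ _)) (congr1 (tw_map tw k) (mul_deltaE F 0 0 0)).
pose t := tw_deg tw l.
pose P := fg_regular (tw_gr tw l).
pose q a : P := delta_mx 0 a * Y.
pose tau a (x : P) : M l := (x : M l) * Y * delta_mx a 0.
have tauq i x : tau i x * E00 = tau i x by rewrite /tau -mulrA mul_deltaE.
have sumE x : \sum_i tau i x *: q i = (x : M l) * Y.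
  rewrite -[in RHS]YY -[X in X * Y](mulr1 Y) one_sum_delta.
  rewrite mulr_sumr mulr_suml mulr_sumr; apply: eq_bigr => i _.
  rewrite /q /tau /GRing.scale /= !mulrA; congr (_ * _).
  by rewrite -!mulrA -(mul_deltaE F i 0 i).
have /(dual_reduction (scal_gdiv (tw_gr tw l)) (e := E00)) red :
    coord (scal (B := M l)) E00 (fun a => t 0 * (t a)^-1)%g q [set: _] tau.
  split.
  - by move=> a b x z; rewrite /tau /GRing.scale /= !mulrDl !mulrA.
  - move=> a h x hx; rewrite invMg invgK; apply: homogM; last exact: tw_elem.
    by rewrite -[h]mulg1; apply: homogM.
  - exact: tauq.
  - move=> k' i; exists (Y k' i)%:A; last first.
      by rewrite /tau /q -(mulrA _ Y Y) YY mul_delta_delta -scalerAl mul1r.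
    exists (Y k' i) => // ne; apply/eqP; apply: contrapT => /negP Y0; apply: ne.
    have := mul_delta_delta 0 k' i 0 Y => /(congr1 (GRing.scale (Y k' i)^-1)).
    rewrite scalerA mulVf // scale1r => E.
    (* If the entry is nonzero, [E_00] is homogeneous of the degree in question
       as well as of degree [1]. *)
    have h1 : tw_gr tw l 1%g (delta_mx 0 0) by rewrite -(mulgV (t 0)); apply: tw_elem.
    have h2 : tw_gr tw l (t 0 * (t k')^-1 * (t i * (t 0)^-1))%g (delta_mx 0 0).
      rewrite -E; apply: homogZ; apply: homogM; last exact: tw_elem.
      by rewrite -[(t 0 * _)%g]mulg1; apply: homogM => //; apply: tw_elem.
    rewrite invMg invgK; apply: contrapT => /eqP ne1.
    have := homog_eq0 h2 h1 ne1 => /matrixP/(_ 0 0)/eqP.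
    by rewrite !mxE !eqxx oner_eq0.
  move=> a _; rewrite (eq_bigl xpredT) => [|i]; last by rewrite inE.
  by rewrite sumE /q -mulrA YY.
have Eq i : (E00 : M l) *: q i = q i by rewrite /q /GRing.scale /= mulrA mul_deltaE.
have [J [f [u [ulin uhom utau usum udual]]]] := red (fun h d => @scal_comm _ _ _ h d _) Eq.
have uE j x : u j x = x * u j 1.
  by rewrite -(coordZ (ulin j) x) /GRing.scale /= mulr1.
exists J, (fun j => t 0 * (t (f j))^-1)%g, (fun j => u j 1), (fun j => q (f j)); split.
- by rewrite -YE; congr (_ _); rewrite -[RHS]mul1r -(sumE 1) -usum.
- by move=> a b; rewrite -uE udual eq_sym.
- by move=> a; rewrite /q mulrA mul_deltaE.
- by move=> a; rewrite utau.
- by move=> a; rewrite -[X in tw_gr _ _ X]mulg1; apply: homogM => //; apply: tw_elem.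
by move=> a; rewrite -[X in tw_gr _ _ X]mul1g; apply: uhom; apply: homog1.
Qed.
End Refinement.

(** * Algebras spanned by the limit and a graded-division algebra *)

(** A finitely generated module has homogeneous generators, and projectivity
    splits the resulting map from a free module.  A splitting [sg] need not be
    graded; its component [s] of degree [1] is still linear and still a
    splitting. *)
Lemma homog_coords (F : fieldType) (H : finGroupType) (B : algType F)
    (gB : grading H B) (P : fgproj gB) :
  exists (I : finType) (dg : I -> H) (p : I -> P) (s : I -> P -> B),
  [/\ forall i, linear (s i : P -> B^o), forall i, fg_homog (dg i) (p i),
      forall i h x, fg_homog h x -> gB (h * (dg i)^-1)%g (s i x) &
      forall x, \sum_i s i x *: p i = x].
Proof.
have [n [e eP]] := fg_fin P.
pose pr (h : H) (x : P) : P := dproj (@fg_sum _ _ _ _ P) h x.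
have prD h : {morph pr h : x y / x + y} by apply: dprojD => ?; apply: fg_subgroup.
have prE g h x : fg_homog g x -> pr h x = if g == h then x else 0.
  by apply: dprojE => ?; apply: fg_subgroup.
have pr0 h : pr h 0 = 0 by apply: (addrI (pr h 0)); rewrite -prD !addr0.
have prS x : x = \sum_h pr h x by apply: dprojS.
have prH h x : fg_homog h (pr h x) by apply: dprojC.
pose dg (i : 'I_n * H) := i.2; pose p i : P := pr i.2 (e i.1).
have ph i : fg_homog (dg i) (p i) by apply: prH.
have prZ h b x i : fg_homog (dg i) x -> pr h (b *: x) = gproj gB (h * (dg i)^-1)%g b *: x.
  move=> hx; rewrite {1}[b](gprojS gB) scaler_suml (big_morph _ (prD h) (pr0 h)).
  rewrite (bigD1 (h * (dg i)^-1)%g) //= big1 ?addr0 => [|k kh].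
    by rewrite (prE _ _ _ (fg_act (gprojC _ _ _) hx)) mulgKV eqxx.
  rewrite (prE _ _ _ (fg_act (gprojC _ _ _) hx)); case: eqP => // kE.
  by rewrite -kE mulgK eqxx in kh.
have pil : linear (fun f : {ffun 'I_n * H -> B^o} => \sum_i (f i : B) *: p i).
  move=> c f g; rewrite scaler_sumr -big_split; apply: eq_bigr => i _ /=.
  by rewrite !ffunE scalerDl scalerA.
have idl : linear (@id P) by [].
have [|sg sgE] := @fg_proj _ _ _ _ P _ _ (mklinear pil) (mklinear idl).
  move=> x /=; have [c xE] := eP x; exists [ffun i => c i.1].
  under eq_bigr do rewrite ffunE.
  rewrite xE -(pair_bigA _ (fun i h => c i *: pr h (e i))) /=; apply: eq_bigr => i _.
  by rewrite -scaler_sumr -prS.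
pose s i x : B := \sum_h gproj gB (h * (dg i)^-1)%g (sg (pr h x) i).
have sgD i x y : sg (x + y) i = sg x i + sg y i by rewrite linearD ffunE.
have sgZ i b x : sg (b *: x) i = b * sg x i by rewrite linearZ_LR ffunE.
have sD i x y : s i (x + y) = s i x + s i y.
  by rewrite -big_split; apply: eq_bigr => h _; rewrite prD sgD gprojD.
have s0 i : s i 0 = 0 by apply: (addrI (s i 0)); rewrite -sD !addr0.
have sH i h x : fg_homog h x -> s i x = gproj gB (h * (dg i)^-1)%g (sg x i).
  move=> hx; rewrite /s (bigD1 h) //= (prE _ _ _ hx) eqxx big1 ?addr0 // => k.
  rewrite eq_sym (prE _ _ _ hx) => /negPf ->.
  by rewrite linear0 ffunE (gprojE _ (homog0 gB 1%g)) if_same.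
have sZ i b x : s i (b *: x) = b * s i x.
  rewrite {1}[b](gprojS gB) {2}[b](gprojS gB) scaler_suml mulr_suml.
  rewrite (big_morph _ (sD i) (s0 i)); apply: eq_bigr => g _.
  rewrite {1}[x](prS x) {2}[x](prS x) scaler_sumr !(big_morph _ (sD i) (s0 i)) mulr_sumr.
  apply: eq_bigr => h _; rewrite (sH i _ _ (prH h x)) (sH i _ _ (fg_act (gprojC gB g b) (prH h x))).
  by rewrite sgZ -mulgA gprojMl //; apply: gprojC.
exists ('I_n * H)%type, dg, p, s; split=> //.
- by move=> i c x y; rewrite sD sZ.
- by move=> i h x hx; rewrite (sH i _ _ hx); apply: gprojC.
move=> x; rewrite [RHS](prS x) {1}[x](prS x).
under eq_bigr => i _ do rewrite (big_morph _ (sD i) (s0 i)) scaler_suml.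
rewrite exchange_big; apply: eq_bigr => h _ /=.
have hx := prH h x; have E := prE _ h _ hx; rewrite eqxx in E.
have E' : \sum_i sg (pr h x) i *: p i = pr h x := sgE (pr h x).
rewrite -[RHS]E -[X in _ = pr h X]E' (big_morph _ (prD h) (pr0 h)).
by apply: eq_bigr => i _; rewrite (sH i _ _ hx) (prZ _ _ _ _ (ph i)).
Qed.

Section Model.
Variables (F : fieldType) (G : finGroupType) (A : algType F) (gA : grading G A).
Variable tw : tower gA.
Local Notation E00 := (delta_mx 0 0).

Variables (H : finGroupType) (B : algType F) (gB : grading H B).
Variables (beta : G -> H) (gamma : {lrmorphism A -> B}) (D : H -> B -> Prop).

(** Sums of products of an element of [A] satisfying [S] with an element of [D],
    all of total degree [h]. *)
Inductive span (S : G -> A -> Prop) : H -> B -> Prop :=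
  | span0 h : span S h 0
  | spanD h g k a d b : S g a -> D k d -> (beta g * k)%g = h -> span S h b ->
      span S h (gamma a * d + b).

(** [B] is spanned by [A], regraded along [beta], and by a graded-division
    algebra [D] centralizing it; [T] consists of the elements of [G] lying over
    the support of [D]. *)
Record model (T : G -> Prop) : Prop := Model {
  md_abel : forall x y : H, (x * y = y * x)%g;
  md_beta : {morph beta : x y / (x * y)%g};
  md_surj : forall h, exists g, beta g = h;
  md_hom : forall g a, gA g a -> gB (beta g) (gamma a);
  md_gd : gdiv gB D;
  md_com : forall a h d, D h d -> d * gamma a = gamma a * d;
  md_T : forall g, (exists2 d, D (beta g) d & d <> 0) <-> T g;
  md_span : forall h b, gB h b -> span gA h b }.

Variables (T : G -> Prop) (mdl : model T).
Let gdD := md_gd mdl.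

Definition corner i : B := gamma (tw_map tw i E00).
Definition stage i (g : G) (a : A) : Prop := exists2 X, tw_gr tw i g X & a = tw_map tw i X.

Lemma beta1 : beta 1%g = 1%g.
Proof. by apply: (mulgI (beta 1%g)); rewrite -(md_beta mdl) !mulg1. Qed.
Lemma betaV g : beta g^-1%g = (beta g)^-1%g.
Proof. by apply: (mulgI (beta g)); rewrite -(md_beta mdl) !mulgV beta1. Qed.

Lemma psi_hom i g X : tw_gr tw i g X -> gB (beta g) (gamma (tw_map tw i X)).
Proof. by move=> hX; apply: (md_hom mdl); apply: tw_hom. Qed.

Lemma gr_E00 i : tw_gr tw i 1%g E00.
Proof. by rewrite -(mulgV (tw_deg tw i 0)); apply: tw_elem. Qed.

Lemma corner_hom i : gB 1%g (corner i).
Proof. by rewrite -beta1; apply/psi_hom/gr_E00. Qed.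

Lemma corner_idem i : corner i * corner i = corner i.
Proof. by rewrite /corner -!rmorphM mul_deltaE. Qed.

Lemma cornerC i h d : D h d -> d * corner i = corner i * d.
Proof. exact: (md_com mdl). Qed.

Lemma corner_neq0 i : corner i <> 0.
Proof.
move=> e0; have inj := @matrix_map_inj _ _ _ (gamma \o tw_map tw i).
have /inj/matrixP/(_ 0 0)/eqP : (gamma \o tw_map tw i) E00 = (gamma \o tw_map tw i) 0.
  by rewrite /= !rmorph0.
by rewrite !mxE !eqxx oner_eq0.
Qed.

Lemma span_sub (S S' : G -> A -> Prop) h b :
  (forall g a, S g a -> S' g a) -> span S h b -> span S' h b.
Proof.
move=> SS; elim=> [{}h|{}h g k a d {}b Sa Dd gk _ IH]; first exact: span0.
by apply: spanD (Dd) gk IH; apply: SS.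
Qed.

Lemma stage_le i j : (i <= j)%N -> forall g a, stage i g a -> stage j g a.
Proof. by move=> ij g _ [X hX ->]; have [Y hY YX] := tw_lift ij hX; exists Y. Qed.

Lemma span_stage h b : gB h b -> exists i, span (stage i) h b.
Proof.
move/(md_span mdl); elim=> [{}h|{}h g k a d {}b ga Dd gk _ [i IH]]; first by exists 0%N; apply: span0.
have [j [X hX Xa]] := tw_cover tw ga; exists (maxn i j).
apply: spanD (Dd) gk _; first by apply: (stage_le (leq_maxr i j)); exists X.
by apply: span_sub IH; apply: stage_le; apply: leq_maxl.
Qed.

(** Finitely many homogeneous elements of [B] come from a single stage, which
    can be taken as late as desired. *)
Lemma span_stage_fin k (J : finType) (h : J -> H) (b : J -> B) :
  (forall j, gB (h j) (b j)) -> exists2 i, (k <= i)%N & forall j, span (stage i) (h j) (b j).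
Proof.
move=> hb; have [i iP] : exists i : J -> nat, forall j, span (stage (i j)) (h j) (b j).
  by exists (fun j => projT1 (cid (span_stage (hb j)))) => j; case: cid.
exists (maxn k (\max_j i j)); first exact: leq_maxl.
move=> j; apply: span_sub (iP j); apply: stage_le.
by apply: leq_trans (leq_maxr _ _); apply: leq_bigmax.
Qed.

Lemma spanMl i g h X b : tw_gr tw i g X -> span (stage i) h b ->
  span (stage i) (beta g * h)%g (gamma (tw_map tw i X) * b).
Proof.
move=> hX; elim=> [{}h|{}h g' k a d {}b [Y hY ->] Dd gk _ IH]; first by rewrite mulr0; apply: span0.
rewrite mulrDr mulrA -!rmorphM; apply: spanD (Dd) _ IH.
  by exists (X * Y) => //; apply: homogM hX hY.
by rewrite (md_beta mdl) -mulgA gk.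
Qed.

Lemma spanMr i g h X b : tw_gr tw i g X -> span (stage i) h b ->
  span (stage i) (h * beta g)%g (b * gamma (tw_map tw i X)).
Proof.
move=> hX; elim=> [{}h|{}h g' k a d {}b [Y hY ->] Dd gk _ IH]; first by rewrite mul0r; apply: span0.
rewrite mulrDl -mulrA (md_com mdl _ Dd) mulrA -!rmorphM; apply: spanD (Dd) _ IH.
  by exists (Y * X) => //; apply: homogM hY hX.
by rewrite (md_beta mdl) -gk -!mulgA; congr (_ * _)%g; apply: (md_abel mdl).
Qed.

(** For [X] in [M_i], [E_00 X E_00] is a scalar multiple of [E_00], and for
    homogeneous [X] the scalar vanishes unless [X] has degree [1].  So the
    degree of [b] is carried by the factor in [D]. *)
Lemma span_corner i h b : span (stage i) h b ->
  exists2 c, D h c & corner i * b * corner i = c * corner i.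
Proof.
elim=> [{}h|{}h g k a d {}b [X hX ->] Dd gk _ [c Dc cE]].
  by exists 0; [exact: (gd0 gdD) | rewrite mulr0 mul0r].
have E : corner i * gamma (tw_map tw i X) * corner i = X 0 0 *: corner i.
  by rewrite /corner -!rmorphM mul_delta_delta /= !linearZ_LR.
exists (X 0 0 *: d + c); last first.
  rewrite mulrDr !mulrDl cE; congr (_ + _).
  by rewrite -!mulrA (cornerC i Dd) !mulrA E (cornerC i (gd_scale gdD (X 0 0) Dd)) -scalerAl -scalerAr.
apply: (gd_add gdD) => //; have [->|/eqP X0] := eqVneq (X 0 0) 0.
  by rewrite scale0r; exact: (gd0 gdD).
apply: (gd_scale gdD); suff g1 : g = 1%g by rewrite -gk g1 beta1 mul1g.
apply: contrapT => /eqP g1; apply: X0.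
have h2 : tw_gr tw i g (X 0 0 *: E00).
  rewrite -mul_delta_delta -[g]mulg1; apply: homogM (gr_E00 i).
  by rewrite -[g]mul1g; apply: homogM hX; apply: gr_E00.
have := homog_eq0 h2 (homogZ _ (gr_E00 i)) g1 => /matrixP/(_ 0 0).
by rewrite !mxE !eqxx mulr1.
Qed.

Lemma dual_basis_stage P k l (L I : finType) (r : L -> G) x y (d : I -> G) q s :
  @refinement _ _ _ _ tw k l L r x y ->
  dual_basis (gB := gB) (P := P) (corner k) (fun i => beta (d i)) q s ->
  dual_basis (corner l) (fun z : L * I => beta (r z.1 * d z.2)%g)
    (fun z => gamma (tw_map tw l (y z.1)) *: q z.2)
    (fun z p => s z.2 p * gamma (tw_map tw l (x z.1))).
Proof.
move=> [rs rd ry rx rhy rhx] bP.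
have -> : (fun z : L * I => beta (r z.1 * d z.2)%g) = fun z => (beta (r z.1) * beta (d z.2))%g.
  by apply/funext => z; rewrite (md_beta mdl).
apply: (@dual_basis_refine _ _ _ gB P (corner k) (corner l) I L
  (fun i => beta (d i)) (fun a => beta (r a))
  (fun a => gamma (tw_map tw l (x a))) (fun a => gamma (tw_map tw l (y a))) q s) bP.
- rewrite /corner -rs !rmorph_sum; apply: eq_bigr => a _; by rewrite -!rmorphM.
- by move=> a b; rewrite -!rmorphM rd; case: ifP; rewrite // !rmorph0.
- by move=> a; rewrite -!rmorphM ry.
- by move=> a; rewrite -!rmorphM rx.
- by move=> a; apply: psi_hom.
- by move=> a; rewrite -betaV; apply: psi_hom.
Qed.

Lemma has_basis_stage P k l (L I : finType) (r : L -> G) x y (d : I -> G) :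
  @refinement _ _ _ _ tw k l L r x y ->
  has_basis (gB := gB) P (corner k) (fun i => beta (d i)) ->
  has_basis P (corner l) (fun z : L * I => beta (r z.1 * d z.2)%g).
Proof. by move=> rf [q [s b]]; do 2 eexists; apply: dual_basis_stage rf b. Qed.

(** Degrees matter only modulo [T]: a homogeneous unit of [D] realizes each
    change. *)
Lemma has_basis_coset P k (I J : finType) (d : I -> G) (d' : J -> G) (h : J -> I) :
  bijective h -> (forall j, T (d' j * (d (h j))^-1)%g) ->
  has_basis (gB := gB) P (corner k) (fun i => beta (d i)) ->
  has_basis P (corner k) (fun j => beta (d' j)).
Proof.
move=> hb hT; apply: (has_basis_twist hb) => j.
have [w Dw w0] := (md_T mdl _).2 (hT j); have [w' Dw' [e1 e2]] := gdV gdD Dw w0.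
rewrite (md_beta mdl) betaV in Dw Dw'.
exists w, w'; split=> //; [exact: (gd_hom gdD)| |exact: cornerC Dw].
by move: (gd_hom gdD Dw'); rewrite invMg invgK.
Qed.

(** [B] is the sum of its left ideals generated by the diagonal matrix units,
    each isomorphic to a shift of the one generated by the corner. *)
Lemma has_basis_reg k :
  has_basis (fg_regular gB) (corner k)
    (fun z : 'I_(tw_n tw k).+1 * unit => beta (tw_deg tw k 0 * (tw_deg tw k z.1)^-1)%g).
Proof.
have -> : (fun z : 'I_(tw_n tw k).+1 * unit => beta (tw_deg tw k 0 * (tw_deg tw k z.1)^-1)%g) =
  fun z => (beta (tw_deg tw k 0 * (tw_deg tw k z.1)^-1) * 1)%g by apply/funext => z; rewrite mulg1.
have [q [s b]] := has_basis_regular gB; do 2 eexists.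
apply: (@dual_basis_refine _ _ _ gB (fg_regular gB) 1 (corner k) _ 'I_(tw_n tw k).+1
  (fun _ => 1%g) (fun a => beta (tw_deg tw k 0 * (tw_deg tw k a)^-1)%g)
  (fun a => gamma (tw_map tw k (delta_mx a 0)))
  (fun a => gamma (tw_map tw k (delta_mx 0 a))) q s) b.
- under eq_bigr do rewrite -!rmorphM mul_deltaE.
  by rewrite -!rmorph_sum -one_sum_delta !rmorph1.
- move=> a b; rewrite -!rmorphM; case: eqP => [->|/eqP ab]; first by rewrite mul_deltaE.
  by rewrite -mulmxE mul_delta_mx_0 // !rmorph0.
- by move=> a; rewrite -!rmorphM mul_deltaE.
- by move=> a; rewrite -!rmorphM mul_deltaE.
- by move=> a; apply: psi_hom; apply: tw_elem.
- by move=> a; rewrite -betaV invMg invgK; apply: psi_hom; apply: tw_elem.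
Qed.

End Model.

Section BasesInModels.
Variables (F : fieldType) (G : finGroupType) (A : algType F) (gA : grading G A).
Variable tw : tower gA.
Variables (H : finGroupType) (B : algType F) (gB : grading H B).
Variables (beta : G -> H) (gamma : {lrmorphism A -> B}) (D : H -> B -> Prop).
Variables (T : G -> Prop) (mdl : model gA gB beta gamma D T).
Let gdD := md_gd mdl.
Local Notation corner := (corner tw gamma).
Local Notation psi i X := (gamma (tw_map tw i X)).

Lemma psi_delta i a b c : psi i (delta_mx a b) * psi i (delta_mx b c) = psi i (delta_mx a c).
Proof. by rewrite -!rmorphM mul_deltaE. Qed.

Lemma psi_one i : \sum_a psi i (delta_mx a 0) * psi i (delta_mx 0 a) = 1.
Proof.
under eq_bigr do rewrite psi_delta.
by rewrite -!rmorph_sum -one_sum_delta !rmorph1.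
Qed.

(** Let [p i] be homogeneous generators with coordinates [s i], and choose a
    stage [k] from which all the [s j (p i)] come.  Cutting with the matrix
    units, the elements [E_0a p i] generate, their coordinates are the
    [s i x * E_a0], and these take values in [D e_k] on generators; so the
    reduction to a basis applies. *)
Lemma has_basis_fgproj (P : fgproj gB) :
  exists k (I : finType) (d : I -> G), has_basis P (corner k) (fun i => beta (d i)).
Proof.
have [I [dg [p [s [sl ph sh ss]]]]] := homog_coords P.
have [sec secE] : exists sec : H -> G, forall h, beta (sec h) = h.
  exists (fun h => projT1 (cid (md_surj mdl h))) => h; by case: cid.
have [k _ kP] := span_stage_fin tw mdl 0
  (fun z : I * I => sh z.2 _ _ (ph z.1)).
pose t := tw_deg tw k.
pose dJ (z : I * 'I_(tw_n tw k).+1) : G := (t 0 * (t z.2)^-1 * sec (dg z.1))%g.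
have dJE z : beta (dJ z) = (beta (t 0 * (t z.2)^-1) * dg z.1)%g.
  by rewrite /dJ (md_beta mdl) secE.
pose q (z : I * 'I_(tw_n tw k).+1) := psi k (delta_mx 0 z.2) *: p z.1.
pose tau (z : I * 'I_(tw_n tw k).+1) x := s z.1 x * psi k (delta_mx z.2 0).
have hE i a : tw_gr tw k (t 0 * (t i)^-1)%g (delta_mx 0 i) /\
    tw_gr tw k (t a * (t 0)^-1)%g (delta_mx a 0) by split; apply: tw_elem.
have qsum x : \sum_z tau z x *: q z = x.
  rewrite -(pair_bigA _ (fun i a => tau (i, a) x *: q (i, a))) /= -[RHS]ss.
  apply: eq_bigr => i _; under eq_bigr do rewrite /tau /q /= scalerA -mulrA mulrA -(mulrA (s i x)).
  by rewrite -scaler_suml -mulr_sumr psi_one mulr1.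
have qe z : corner k *: q z = q z by rewrite /q scalerA psi_delta.
have taue z x : tau z x * corner k = tau z x by rewrite /tau -mulrA psi_delta.
have tauh z h x : fg_homog h x -> gB (h * (beta (dJ z))^-1)%g (tau z x).
  move=> hx; rewrite dJE invMg mulgA -(betaV mdl) invMg invgK; apply: homogM; first exact: sh.
  exact: (psi_hom mdl) (proj2 (hE 0 z.2)).
have [|J [f [u [ulin uhom utau usum udual]]]] :=
    dual_reduction (dg := fun z => beta (dJ z)) gdD (fun h d Dd => cornerC tw mdl k Dd) qe (tau := tau).
  split=> //.
  - by move=> z b x y; rewrite /tau sl mulrDl -mulrA.
  - move=> z z'.
    have h1 := spanMr mdl (proj2 (hE 0 z'.2)) (spanMl mdl (proj1 (hE z.2 0)) (kP (z.1, z'.1))).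
    have [c Dc cE] := span_corner mdl h1.
    exists c.
      move: Dc; rewrite !dJE invMg -(betaV mdl (_ * _)) invMg invgK !mulgA; exact.
    rewrite -cE /tau /q (coordZ (sl _)) !mulrA psi_delta -!mulrA psi_delta //.
  by move=> z _; rewrite -[RHS]qsum; apply: eq_bigl => z'; rewrite inE.
exists k, J, (fun j => dJ (f j)), (fun j => q (f j)), u; split=> //.
- move=> j; rewrite dJE; apply: fg_act (ph _).
  exact: (psi_hom mdl) (proj1 (hE _ 0)).
- by move=> x; rewrite usum qsum.
Qed.

Lemma corner_regular k h c : D h c -> c * corner k = 0 -> c = 0.
Proof.
move=> Dc c0; apply: contrapT => cn0; have [y _ [_ yc]] := gdV gdD Dc cn0.
by apply: (corner_neq0 (tw := tw) (gamma := gamma) (i := k)); rewrite -[RHS](mulr0 y) -c0 mulrA yc mul1r.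
Qed.

(** The transition matrices between two bases, when their entries come from the
    stage of the corner, are [e_l] times homogeneous matrices over [D].  These
    are inverse to each other because right multiplication by [e_l] is
    injective on homogeneous elements of [D]. *)
Lemma transition_matching (P : fgproj gB) l (I J : finType) (d : I -> H) (d' : J -> H) q s q' s' :
    dual_basis (P := P) (corner l) d q s -> dual_basis (corner l) d' q' s' ->
    (forall z z', span beta gamma D (stage tw l) (d z * (d' z')^-1)%g (s' z' (q z))) ->
    (forall z' z, span beta gamma D (stage tw l) (d' z' * (d z)^-1)%g (s z (q' z'))) ->
  exists2 h : I -> J, bijective h &
    forall z, exists2 w, D (d z * (d' (h z))^-1)%g w & w <> 0.
Proof.
have coef (K L : finType) (dk : K -> H) (dl : L -> H) qk sk ql sl :
    dual_basis (P := P) (corner l) dk qk sk -> dual_basis (P := P) (corner l) dl ql sl ->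
    (forall z z', span beta gamma D (stage tw l) (dk z * (dl z')^-1)%g (sl z' (qk z))) ->
    exists u : K -> L -> B, forall z z', D (dk z * (dl z')^-1)%g (u z z') /\
      sl z' (qk z) = u z z' * corner l.
  move=> bk bl hs.
  have C z z' : exists2 c, D (dk z * (dl z')^-1)%g c & sl z' (qk z) = c * corner l.
    have [c Dc cE] := span_corner mdl (hs z z'); exists c => //.
    by rewrite -cE -mulrA (db_tau bl) -(coordZ (db_lin bl z')) (db_q bk).
  by exists (fun z z' => projT1 (cid2 (C z z'))) => z z'; case: cid2.
have prod (K L : finType) (dk : K -> H) (dl : L -> H) qk sk ql sl u v :
    dual_basis (P := P) (corner l) dk qk sk -> dual_basis (P := P) (corner l) dl ql sl ->
    (forall z z', D (dk z * (dl z')^-1)%g (u z z') /\ sl z' (qk z) = u z z' * corner l) ->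
    (forall z' z, D (dl z' * (dk z)^-1)%g (v z' z) /\ sk z (ql z') = v z' z * corner l) ->
    forall a c, \sum_b u a b * v b c = if a == c then 1 else 0.
  move=> bk bl hu hv a c; apply/eqP; rewrite -subr_eq0; apply/eqP.
  have DS : D (dk a * (dk c)^-1)%g (\sum_b u a b * v b c - (if a == c then 1 else 0)).
    apply: (gd_sub gdD); last first.
      by case: eqP => [->|_]; [rewrite mulgV; exact: (gd1 gdD) | exact: (gd0 gdD)].
    elim/big_rec: _ => [|b x _ Dx]; first exact: (gd0 gdD).
    apply: (gd_add gdD) => //.
    have -> : (dk a * (dk c)^-1 = (dk a * (dl b)^-1) * (dl b * (dk c)^-1))%g by rewrite mulgA mulgKV.
    by apply: (gdM gdD); [case: (hu a b) | case: (hv b c)].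
  apply: (corner_regular DS (k := l)); rewrite mulrBl mulr_suml; apply/eqP; rewrite subr_eq0; apply/eqP.
  transitivity (sk c (qk a)); last first.
    by rewrite (db_dual bk) eq_sym; case: eqP => _; rewrite ?mul1r ?mul0r.
  rewrite -(db_sum bl (qk a)) (coord_sum (db_lin bk c)); apply: eq_bigr => b _.
  rewrite (coordZ (db_lin bk c)); have [_ ->] := hu a b; have [Dv ->] := hv b c.
  by rewrite -!mulrA (mulrA (corner l)) -(cornerC tw mdl l Dv) -mulrA corner_idem.
move=> b b' h h'.
have [u hu] := coef _ _ _ _ _ _ _ _ b b' h; have [v hv] := coef _ _ _ _ _ _ _ _ b' b h'.
apply: (homog_invertible_bij gdD (u := u) (v := v)).
- by move=> z z'; case: (hu z z').
- by move=> z z'; case: (hv z z').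
- exact: prod b b' hu hv.
- exact: prod b' b hv hu.
Qed.

(** The transition matrices at stage [k] have entries that come from a later
    stage [l].  After both bases are refined to stage [l], the new entries are
    the old ones multiplied by elements of that same stage, and so they come
    from it as well. *)
Lemma two_bases (P : fgproj gB) k (I J : finType) (d : I -> G) (d' : J -> G) :
  has_basis P (corner k) (fun i => beta (d i)) -> has_basis P (corner k) (fun j => beta (d' j)) ->
  exists2 l, (k <= l)%N & forall (L : finType) (r : L -> G) x y,
    @refinement _ _ _ _ tw k l L r x y ->
    exists2 h : L * I -> L * J, bijective h &
      forall z, T (r z.1 * d z.2 * (r (h z).1 * d' (h z).2)^-1)%g.
Proof.
move=> [q [s b]] [q' [s' b']].
pose hh (z : I * J + J * I) : H := match z with
  | inl z => (beta (d z.1) * (beta (d' z.2))^-1)%g | inr z => (beta (d' z.1) * (beta (d z.2))^-1)%g end.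
pose bb (z : I * J + J * I) : B := match z with
  | inl z => s' z.2 (q z.1) | inr z => s z.2 (q' z.1) end.
have [z|l kl lP] := span_stage_fin tw mdl k (h := hh) (b := bb).
  case: z => z /=; first exact: db_thom b' _ _ _ (db_hom b _).
  exact: db_thom b _ _ _ (db_hom b' _).
exists l => // L r x y rf.
have B1 := dual_basis_stage mdl rf b; have B2 := dual_basis_stage mdl rf b'.
have sp (K K' : finType) (dk : K -> G) (dk' : K' -> G) (i : K) (j : K') m m' c :
    span beta gamma D (stage tw l) (beta (dk i) * (beta (dk' j))^-1)%g c ->
    span beta gamma D (stage tw l) (beta (r m * dk i) * (beta (r m' * dk' j))^-1)%g
      (psi l (y m) * c * psi l (x m')).
  move=> /(spanMl mdl (rf_hy rf m))/(spanMr mdl (rf_hx rf m')).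
  by rewrite !(md_beta mdl) (betaV mdl) invMg !mulgA.
have [|z' z|h hb hw] := transition_matching B1 B2.
- move=> [m i] [m' j] /=; rewrite (coordZ (db_lin b' j)).
  exact: sp (lP (inl (i, j))).
- case: z z' => m i [m' j] /=; rewrite (coordZ (db_lin b i)).
  exact: sp (lP (inr (j, i))).
exists h => // z; apply/(md_T mdl).
by rewrite (md_beta mdl) (betaV mdl); have := hw z.
Qed.
End BasesInModels.

(** * From a correspondence of modules to an isomorphism of triples *)

Section Completion.
Variables (M N : cmonoid) (theta : M -> N).
Hypothesis thetaD : forall x y, theta (cmD x y) = cmD (theta x) (theta y).

Definition gc_lift (x : gc M) : gc N := gc_class (theta (qrepr x).1, theta (qrepr x).2).

Lemma gc_lift_class p : gc_lift (gc_class p) = gc_class (theta p.1, theta p.2).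
Proof.
apply/gc_classP; have [r e] := gc_reprP p; exists (theta r) => /=.
by rewrite -!thetaD e.
Qed.

Lemma gc_liftD x y : gc_lift (gcD x y) = gcD (gc_lift x) (gc_lift y).
Proof.
have [p ->] := gc_ex x; have [q ->] := gc_ex y.
by rewrite gcD_class !gc_lift_class gcD_class /= !thetaD.
Qed.
End Completion.

Lemma gc_lift_cancel (M N : cmonoid) (theta : M -> N) (theta' : N -> M) :
  (forall x y, theta (cmD x y) = cmD (theta x) (theta y)) ->
  (forall x y, theta' (cmD x y) = cmD (theta' x) (theta' y)) ->
  cancel theta theta' -> cancel (gc_lift theta) (gc_lift theta').
Proof.
move=> h h' c x; have [p ->] := gc_ex x.
by rewrite !gc_lift_class //= !c -surjective_pairing.
Qed.

Section Induced.
Variables (F : fieldType) (H1 H2 : finGroupType) (B1 B2 : algType F).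
Variables (g1 : grading H1 B1) (g2 : grading H2 B2).
Variable R : fgproj g1 -> fgproj g2 -> Prop.
Hypothesis R_total : forall P, exists Q, R P Q.
Hypothesis R_iso : forall P Q P' Q', R P Q -> R P' Q' -> fg_iso P P' -> fg_iso Q Q'.
Hypothesis R_oplus : forall P Q P' Q', R P Q -> R P' Q' -> R (fg_oplus P P') (fg_oplus Q Q').

Definition induced (x : K0monoid g1) : K0monoid g2 :=
  K0class (projT1 (cid (R_total (qrepr x)))).

Lemma induced_class P Q : R P Q -> induced (K0class P) = K0class Q.
Proof.
move=> PQ; apply/K0classP; case: cid => Q' /= h; apply: R_iso h PQ _.
exact: K0class_repr.
Qed.

Lemma inducedD x y : induced (cmD x y) = cmD (induced x) (induced y).
Proof.
have [P ->] := K0class_ex x; have [P' ->] := K0class_ex y.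
have [Q PQ] := R_total P; have [Q' PQ'] := R_total P'.
rewrite (induced_class PQ) (induced_class PQ') /= !K0posD_class.
exact/induced_class/R_oplus.
Qed.
End Induced.

Section Isomorphism.
Variables (F : fieldType) (G H : finGroupType) (B1 B2 : algType F).
Variables (g1 : grading G B1) (g2 : grading H B2).
Hypotheses (abG : abelian [set: G]) (abH : abelian [set: H]).
Variables (alpha : G -> H) (alphaM : {morph alpha : x y / (x * y)%g}).
Variable R : fgproj g1 -> fgproj g2 -> Prop.
Hypothesis R_total : forall P, exists Q, R P Q.
Hypothesis R_total' : forall Q, exists P, R P Q.
Hypothesis R_iso : forall P Q P' Q', R P Q -> R P' Q' -> (fg_iso P P' <-> fg_iso Q Q').
Hypothesis R_oplus : forall P Q P' Q', R P Q -> R P' Q' -> R (fg_oplus P P') (fg_oplus Q Q').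
Hypothesis R_shift : forall g P Q, R P Q -> R (fg_shift g P) (fg_shift (alpha g) Q).
Hypothesis R_zero : R (fg_zero g1) (fg_zero g2).
Hypothesis R_reg : R (fg_regular g1) (fg_regular g2).

Lemma K0_iso_of_correspondence : triple_iso (K0 g1 abG) (restrict alphaM (K0 g2 abH)).
Proof.
pose R' Q P := R P Q.
have i1 P Q P' Q' : R P Q -> R P' Q' -> fg_iso P P' -> fg_iso Q Q'.
  by move=> h h'; case: (R_iso h h').
have i2 Q P Q' P' : R' Q P -> R' Q' P' -> fg_iso Q Q' -> fg_iso P P'.
  by move=> h h'; case: (R_iso h h').
have o2 Q P Q' P' : R' Q P -> R' Q' P' -> R' (fg_oplus Q Q') (fg_oplus P P') by apply: R_oplus.
pose th := induced R_total; pose th' := induced (R := R') R_total'.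
have thE P Q : R P Q -> th (K0class P) = K0class Q by apply: induced_class.
have thE' P Q : R P Q -> th' (K0class Q) = K0class P by apply: (induced_class _ i2).
have thD : forall x y, th (cmD x y) = cmD (th x) (th y) by apply: inducedD.
have thD' : forall x y, th' (cmD x y) = cmD (th' x) (th' y) by apply: inducedD.
have c1 : cancel th th'.
  by move=> x; have [P ->] := K0class_ex x; have [Q PQ] := R_total P; rewrite (thE _ _ PQ) (thE' _ _ PQ).
have c2 : cancel th' th.
  by move=> x; have [Q ->] := K0class_ex x; have [P PQ] := R_total' Q; rewrite (thE' _ _ PQ) (thE _ _ PQ).
have thS g x : th (K0shift g x) = K0shift (alpha g) (th x).
  have [P ->] := K0class_ex x; have [Q PQ] := R_total P.
  by rewrite (thE _ _ PQ) !K0shift_class; apply/thE/R_shift.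
have thS' g x : th' (K0shift (alpha g) x) = K0shift g (th' x).
  by apply: (can_inj c1); rewrite thS !c2.
have th0 : th (cm0 _) = cm0 _ by apply: thE.
have th0' : th' (cm0 _) = cm0 _ by apply: thE'.
have act1 g x : gc_lift th (K0act g x) = K0act (alpha g) (gc_lift th x).
  have [[p q] ->] := gc_ex x; rewrite /K0act gc_map_class ?gc_lift_class //; last exact: K0shiftD.
  by rewrite gc_map_class /= ?thS //; apply: K0shiftD.
have act2 g x : gc_lift th' (K0act (alpha g) x) = K0act g (gc_lift th' x).
  have [[p q] ->] := gc_ex x; rewrite /K0act gc_map_class ?gc_lift_class //; last exact: K0shiftD.
  by rewrite gc_map_class /= ?thS' //; apply: K0shiftD.
have of1 P Q : R P Q -> gc_lift th (gc_of (K0class P : K0monoid g1)) = gc_of (K0class Q : K0monoid g2).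
  by move=> PQ; rewrite /gc_of gc_lift_class //= th0 (thE _ _ PQ).
have of2 P Q : R P Q -> gc_lift th' (gc_of (K0class Q : K0monoid g2)) = gc_of (K0class P : K0monoid g1).
  by move=> PQ; rewrite /gc_of gc_lift_class //= th0' (thE' _ _ PQ).
have p1 x : tpos (K0 g1 abG) x -> tpos (restrict alphaM (K0 g2 abH)) (gc_lift th x).
  by move=> [P ->]; have [Q PQ] := R_total P; exists Q; apply: of1.
have p2 x : tpos (restrict alphaM (K0 g2 abH)) x -> tpos (K0 g1 abG) (gc_lift th' x).
  by move=> [Q ->]; have [P PQ] := R_total' Q; exists P; apply: of2.
exists (@TripleHom G (K0 g1 abG) (restrict alphaM (K0 g2 abH)) (gc_lift th)
  (gc_liftD thD) act1 p1 (of1 _ _ R_reg)).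
exists (@TripleHom G (restrict alphaM (K0 g2 abH)) (K0 g1 abG) (gc_lift th')
  (gc_liftD thD') act2 p2 (of2 _ _ R_reg)).
by split; apply: gc_lift_cancel.
Qed.
End Isomorphism.

Section Correspondence.
Variables (F : fieldType) (G : finGroupType) (A : algType F) (gA : grading G A).
Variables (tw : tower gA) (T : G -> Prop).
Variables (H1 H2 : finGroupType) (B1 B2 : algType F).
Variables (g1 : grading H1 B1) (g2 : grading H2 B2).
Variables (beta1 : G -> H1) (gamma1 : {lrmorphism A -> B1}) (D1 : H1 -> B1 -> Prop).
Variables (beta2 : G -> H2) (gamma2 : {lrmorphism A -> B2}) (D2 : H2 -> B2 -> Prop).

(** [P] and [Q] are described by the same shifts at the same stage, each over its
    own algebra. *)
Definition correspond (P : fgproj g1) (Q : fgproj g2) : Prop :=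
  exists k (I : finType) (d : I -> G),
    has_basis P (corner tw gamma1 k) (fun i => beta1 (d i)) /\
    has_basis Q (corner tw gamma2 k) (fun i => beta2 (d i)).

Hypotheses (mdl1 : model gA g1 beta1 gamma1 D1 T) (mdl2 : model gA g2 beta2 gamma2 D2 T).

Lemma correspond_total P : exists Q, correspond P Q.
Proof.
have [k [I [d bP]]] := has_basis_fgproj tw mdl1 P.
exists (fg_free (corner_idem tw gamma2 k) (corner_hom tw mdl2 k) (fun i => beta2 (d i))), k, I, d.
by split=> //; apply: has_basis_free.
Qed.

Lemma correspond_stage P Q P' Q' : correspond P Q -> correspond P' Q' ->
  exists l (I J : finType) (d : I -> G) (d' : J -> G),
    [/\ has_basis P (corner tw gamma1 l) (fun i => beta1 (d i)),
        has_basis Q (corner tw gamma2 l) (fun i => beta2 (d i)),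
        has_basis P' (corner tw gamma1 l) (fun i => beta1 (d' i)) &
        has_basis Q' (corner tw gamma2 l) (fun i => beta2 (d' i))].
Proof.
move=> [k [I [d [bP bQ]]]] [k' [J [d' [bP' bQ']]]].
have [L [r [x [y rf]]]] := refinement_exists tw (leq_maxl k k').
have [L' [r' [x' [y' rf']]]] := refinement_exists tw (leq_maxr k k').
exists (maxn k k'), (L * I)%type, (L' * J)%type.
exists (fun z => r z.1 * d z.2)%g, (fun z => r' z.1 * d' z.2)%g.
split.
- exact: (has_basis_stage mdl1 rf bP).
- exact: (has_basis_stage mdl2 rf bQ).
- exact: (has_basis_stage mdl1 rf' bP').
- exact: (has_basis_stage mdl2 rf' bQ').
Qed.

(** Isomorphic [P] and [P'] have degree families that match modulo [T] after
    refinement; the refinement and [T] are common to both models, so the same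
    matching applies to [Q] and [Q']. *)
Lemma correspond_iso P Q P' Q' : correspond P Q -> correspond P' Q' ->
  fg_iso P P' -> fg_iso Q Q'.
Proof.
move=> PQ PQ' PP'; have [k [I [J [d [d' [bP bQ bP' bQ']]]]]] := correspond_stage PQ PQ'.
have bP2 := has_basis_transport (fg_iso_sym PP') bP'.
have [l kl hl] := two_bases mdl1 bP bP2.
have [L [r [x [y rf]]]] := refinement_exists tw kl.
have [h hb hT] := hl _ _ _ _ rf.
apply: (has_basis_iso (has_basis_stage mdl2 rf bQ)).
exact: (has_basis_coset mdl2 hb hT (has_basis_stage mdl2 rf bQ')).
Qed.

Lemma correspond_oplus P Q P' Q' : correspond P Q -> correspond P' Q' ->
  correspond (fg_oplus P P') (fg_oplus Q Q').
Proof.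
move=> PQ PQ'; have [k [I [J [d [d' [bP bQ bP' bQ']]]]]] := correspond_stage PQ PQ'.
exists k, (I + J)%type, (fun z => match z with inl i => d i | inr j => d' j end).
split.
  have := has_basis_oplus bP bP'; congr has_basis; apply/funext; by case.
have := has_basis_oplus bQ bQ'; congr has_basis; apply/funext; by case.
Qed.

Lemma correspond_shift g P Q : correspond P Q ->
  correspond (fg_shift (beta1 g) P) (fg_shift (beta2 g) Q).
Proof.
move=> [k [I [d [bP bQ]]]]; exists k, I, (fun i => d i * g)%g; split.
  have := has_basis_shift (beta1 g) bP; congr has_basis; apply/funext => i.
  by rewrite (md_beta mdl1).
have := has_basis_shift (beta2 g) bQ; congr has_basis; apply/funext => i.
by rewrite (md_beta mdl2).
Qed.

Lemma has_basis_zero (H : finGroupType) (B : algType F) (gB : grading H B) e (dg : void -> H) :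
  has_basis (fg_zero gB) e dg.
Proof.
exists (fun=> 0), (fun _ _ => 0); split; try by case.
by move=> x; rewrite [RHS](thinmx0 x) big1.
Qed.

Lemma correspond_zero : correspond (fg_zero g1) (fg_zero g2).
Proof. by exists 0%N, void, (fun=> 1%g); split; apply: has_basis_zero. Qed.

Lemma correspond_reg : correspond (fg_regular g1) (fg_regular g2).
Proof.
by exists 0%N; do 2 eexists; split; [exact: (has_basis_reg tw mdl1) | exact: (has_basis_reg tw mdl2)].
Qed.
End Correspondence.

Lemma correspond_sym (F : fieldType) (G H1 H2 : finGroupType) (A B1 B2 : algType F)
    (gA : grading G A) (tw : tower gA) (g1 : grading H1 B1) (g2 : grading H2 B2)
    beta1 gamma1 beta2 gamma2 (P : fgproj g1) (Q : fgproj g2) :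
  correspond tw beta1 gamma1 beta2 gamma2 P Q -> correspond tw beta2 gamma2 beta1 gamma1 Q P.
Proof. by move=> [k [I [d [bP bQ]]]]; exists k, I, d. Qed.

(** * The two models *)

Section TensorModel.
Variables (F : fieldType) (gT : finGroupType) (abG : abelian [set: gT]).
Variables (D : algType F) (gD : grading gT D) (T : {group gT}).
Hypotheses (divD : graded_division gD) (suppD : forall g : gT, g \in T <-> gsupport gD g).
Variables (A : algType F) (gA : grading gT A).

Lemma tens_left_morphism : exists gamma : {lrmorphism A -> tens A D}, forall a, gamma a = tens_pure a 1.
Proof.
pose f (a : A) : tens A D := tens_pure a 1.
have fl : linear f by move=> c x y; apply: (tens_pure_bilin A D).1.
have fm : GRing.monoid_morphism f by split=> // x y; rewrite /f tens_pureM mulr1.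
pose gamma : {lrmorphism A -> tens A D} :=
  HB.pack f (GRing.isLinear.Build _ _ _ _ f fl) (GRing.isMonoidMorphism.Build _ _ f fm).
by exists gamma.
Qed.

Definition right_factor (h : gT) (b : tens A D) : Prop := exists2 d, gD h d & b = tens_pure 1 d.

(** Graded division only asks for some inverse; its component of the opposite
    degree is already an inverse. *)
Lemma homog_inv h d : gD h d -> d <> 0 ->
  exists2 y, gD h^-1%g y & d * y = 1 /\ y * d = 1.
Proof.
move=> hd d0; have [y [dy yd]] := divD hd d0; exists (gproj gD h^-1%g y); first exact: gprojC.
rewrite -(gprojMl _ _ hd) -(gprojMr _ _ hd) mulgV mulVg dy yd.
by rewrite (gproj_id (homog1 gD)).
Qed.

Lemma right_factor_gdiv : gdiv (tens_grading abG gA gD) right_factor.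
Proof.
split.
- move=> h _ [d hd ->]; rewrite -[h]mul1g; apply: tens_homog_pure => //; exact: homog1.
- by move=> h; exists 0; [exact: homog0 | rewrite tens_pure0r].
- move=> h c _ _ [d hd ->] [d' hd' ->]; exists (c *: d + d'); first exact: homogP.
  by rewrite (tens_pure_bilin A D).2.
- by exists 1 => //; apply: homog1.
- move=> g h _ _ [d hd ->] [d' hd' ->]; exists (d * d'); first exact: homogM.
  by rewrite tens_pureM mulr1.
- move=> h _ [d hd ->] d0; have [|y hy [dy yd]] := homog_inv hd.
    by move=> d1; apply: d0; rewrite d1 tens_pure0r.
  by exists (tens_pure 1 y); [exists y | rewrite !tens_pureM !mulr1 dy yd].
Qed.

Lemma tensor_model (gamma : {lrmorphism A -> tens A D}) : (forall a, gamma a = tens_pure a 1) ->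
  model gA (tens_grading abG gA gD) id gamma right_factor (fun g => g \in T).
Proof.
move=> gammaE; split=> //.
- move=> x y; have /centsP/(_ x (finset.in_setT x) y (finset.in_setT y)) := abG; exact.
- by move=> h; exists h.
- by move=> g a ga; rewrite gammaE -[g]mulg1; apply: tens_homog_pure => //; apply: homog1.
- exact: right_factor_gdiv.
- by move=> a h _ [d hd ->]; rewrite gammaE !tens_pureM !mul1r !mulr1.
- move=> g; rewrite suppD; split=> [[_ [d hd ->] d0]|[d [hd d0]]].
    by exists d; split=> // d1; apply: d0; rewrite d1 tens_pure0r.
  exists (tens_pure 1 d); first by exists d.
  have [y _ [dy _]] := homog_inv hd d0.
  move=> d1; have := tens_pureM (1 : A) d 1 y; rewrite d1 mul0r mulr1 dy => /esym/eqP.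
  by have := oner_neq0 (tens A D) => /negPf; rewrite -[1]/(tens_pure 1 1) => ->.
move=> h _ [s [-> hs]].
elim: s hs => [|p s IH] hs; first by rewrite big_nil; apply: span0.
have [g [k [ga kd gk]]] := hs p (mem_head _ _).
rewrite big_cons; have -> : tens_pure p.1 p.2 = gamma p.1 * tens_pure 1 p.2.
  by rewrite gammaE tens_pureM mulr1 mul1r.
apply: spanD gk _ => //; first by exists p.2.
by apply: IH => r rs; apply: hs; rewrite inE rs orbT.
Qed.
End TensorModel.

(** The scalars are a graded-division algebra with trivial support, and an
    element of the group lies over the identity of [G/T] exactly when it is in [T]. *)
Section CoarseModel.
Variables (F : fieldType) (gT : finGroupType) (abG : abelian [set: gT]) (T : {group gT}).
Variables (A : algType F) (gA : grading gT A).

Lemma coarse_model :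
  model gA (coarsen (coset_morph T abG) gA) (coset T) idfun (scal (B := A)) (fun g => g \in T).
Proof.
split.
- move=> x y; have /centsP/(_ x (finset.in_setT x) y (finset.in_setT y)) := abelian_coset T abG; exact.
- exact: coset_morph.
- by move=> h; case: (cosetP h) => x _ ->; exists x.
- move=> g a ga; exists (fun k => if k == g then a else 0); split=> [k|].
    by case: eqP => [->|_] //; apply: homog0.
  rewrite (bigD1 g) //= eqxx big1 ?addr0 // => k /andP[_ /negPf ->] //.
- exact: scal_gdiv.
- by move=> a h d; apply: scal_comm.
- move=> g; split=> [[_ [c -> hc] c0]|gT'].
    apply: coset_idr; first exact: norm_abelian.
    by apply: contrapT => /hc c1; apply: c0; rewrite c1 scale0r.
  by exists 1; [exists 1; rewrite ?scale1r // (coset_id gT') | apply/eqP/oner_neq0].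
move=> h _ [f [hf ->]]; elim/big_rec: _ => [|g x /eqP gh IH]; first exact: span0.
rewrite -[f g]mulr1; apply: (spanD (gamma := idfun) (g := g) (k := 1%g)) => //.
  by exists 1; rewrite ?scale1r.
by rewrite mulg1.
Qed.
End CoarseModel.

(** * Graded K-theory of the tensor product *)

Theorem proposition18 (F : closedFieldType) (gT : finGroupType)
    (abG : abelian [set: gT])
    (D : algType F) (gD : grading gT D) (T : {group gT})
    (divD : graded_division gD)
    (suppD : forall g : gT, g \in T <-> gsupport gD g)
    (A : algType F) (gA : grading gT A)
    (limA : limit_of_elementary gA) :
  triple_iso
    (K0 (tens_grading abG gA gD) abG)
    (restrict (coset_morph T abG)
       (K0 (coarsen (coset_morph T abG) gA) (abelian_coset T abG))).
Proof.
have [tw _] := tower_of_limit limA.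
have [gamma gammaE] := tens_left_morphism D A.
have m1 := tensor_model abG divD suppD gA gammaE.
have m2 := coarse_model abG T gA.
apply: (@K0_iso_of_correspondence _ _ _ _ _ _ _ _ _ _ _ (correspond tw id gamma (coset T) idfun)).
- exact: (correspond_total tw m1 m2).
- by move=> Q; have [P /correspond_sym QP] := correspond_total tw m2 m1 Q; exists P.
- move=> P Q P' Q' PQ PQ'; split; first exact: (correspond_iso m1 m2 PQ PQ').
  exact: (correspond_iso m2 m1 (correspond_sym PQ) (correspond_sym PQ')).
- exact: (correspond_oplus m1 m2).
- exact: (correspond_shift m1 m2).
- exact: correspond_zero.
- exact: (correspond_reg tw m1 m2).
Qed.
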